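(* Let $(M,\omega,\mathcal P)$ be a polarized symplectic manifold or a formal polarized symplectic manifold. Then there exists a $\mathcal P$-symplectic connection on $M$.
   Context: $M$ is a smooth manifold, $C_M^\infty$ the sheaf of complex-valued smooth functions, $\mathcal T^{\mathbb C}_M$ its complexified tangent bundle; $(dx_i)^\perp$ is the common kernel of the $dx_i$. A polarized symplectic manifold $(M,\omega,\mathcal P)$: $\omega$ is a closed nondegenerate complex 2-form and $\mathcal P\subset\mathcal T^{\mathbb C}_M$ a complex subbundle such that locally there exist complex-valued functions $x_i,y_i$, $i=1,\dots,\frac12\dim M$ (with linearly independent differentials), with $\omega=\sum_i dy_i\wedge dx_i$ and $\mathcal P=(dx_i)^\perp$. Formal version: $t$ is a formal parameter, $\omega=\omega_0+t\omega_1+\cdots$ is a formal closed 2-form with $\omega_0$ nondegenerate, $\mathcal P\subset\mathcal T^{\mathbb C}_M[[t]]$ is a formal subbundle (a $t$-adically complete subsheaf of $C_M^\infty[[t]]$-modules such that $tb\in\mathcal P$, $b\in\mathcal T^{\mathbb C}_M[[t]]$ imply $b\in\mathcal P$), and locally there are formal coordinates $x_i,y_i\in C_M^\infty[[t]]$ with $\omega=\sum dy_i\wedge dx_i$ and $\mathcal P=(dx_i)^\perp$. Let $\mathcal T$ be $\mathcal T^{\mathbb C}_M$ (resp. $\mathcal T^{\mathbb C}_M[[t]]$ in the formal case). A $\mathcal P$-symplectic connection is a connection $\nabla$ on $\mathcal T$ such that: (a) it preserves $\omega$ and is torsion free; (b) it preserves $\mathcal P$, i.e. $\nabla_X(\mathcal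 P)\subset\mathcal P$ for any $X\in\mathcal T$; (c) it is flat on $\mathcal P$ along $\mathcal P$, i.e. $(\nabla_X\nabla_Y-\nabla_Y\nabla_X-\nabla_{[X,Y]})(\mathcal P)=0$ for any $X,Y\in\mathcal P$. *)

(* Defs.v *)
From HB Require Import structures.
From mathcomp Require Import all_boot all_order all_algebra.
From mathcomp Require Import complex.
From mathcomp Require Import all_classical all_reals all_analysis.

Set Implicit Arguments.
Unset Strict Implicit.
Unset Printing Implicit Defensive.

Import Order.TTheory GRing.Theory Num.Theory numFieldNormedType.Exports.

Local Open Scope classical_set_scope.
Local Open Scope ring_scope.
Local Open Scope complex_scope.

Section EuclideanSmoothness.
Variables (R : realType) (n : nat).
Implicit Types (D : set 'rV[R]_n) (f : 'rV[R]_n -> R).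

Fixpoint Ck (k : nat) D f : Prop :=
  if k is k'.+1 then
    (forall u (i : 'I_n), D u -> derivable f u (delta_mx 0 i)) /\
    (forall i : 'I_n, Ck k' D (fun u => 'D_(delta_mx 0 i) f u))
  else forall u, D u -> {for u, continuous f}.

Definition smooth_rn D f := forall k, Ck k D f.

End EuclideanSmoothness.

Record chart (R : realType) (n : nat) (T : topologicalType) := Chart {
  cdom : set T;
  cmap : T -> 'rV[R]_n;
  cinv : 'rV[R]_n -> T;
  cdom_open : open cdom;
  cimg_open : open (cmap @` cdom);
  cmapK : forall x, cdom x -> cinv (cmap x) = x;
  cmap_continuous : {within cdom, continuous cmap};
  cinv_continuous : {within cmap @` cdom, continuous cinv} }.

Record smoothManifold (R : realType) (n : nat) := SmoothManifold {
  carrier :> topologicalType;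
  manifold_hausdorff : hausdorff_space carrier;
  manifold_countable : @second_countable carrier;
  atlas : set (chart R n carrier);
  atlas_cover : forall x : carrier, exists2 c, atlas c & cdom c x;
  atlas_compat : forall c d, atlas c -> atlas d -> forall j : 'I_n,
    smooth_rn (cmap c @` (cdom c `&` cdom d))
              (fun u => cmap d (cinv c u) 0 j) }.

Section Tangent.
Variables (R : realType) (n : nat) (M : smoothManifold R n).

(* Sections over an open set [U] are represented by total functions on [M],
   whose values outside [U] are irrelevant. *)
Definition cfunc := M -> R[i].

Definition smooth (U : set M) (f : cfunc) := forall c, atlas c ->
  smooth_rn (cmap c @` (cdom c `&` U)) (fun u => complex.Re (f (cinv c u))) /\
  smooth_rn (cmap c @` (cdom c `&` U)) (fun u => complex.Im (f (cinv c u))).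

Definition smooth_at (x : M) (f : cfunc) :=
  exists U : set M, [/\ open U, U x & smooth U f].

Definition tvec := cfunc -> R[i].

(* The complexified tangent space at [x]: complex derivations of the ring of
   germs at [x] of smooth complex functions.  Setting [v f = 0] when [f] is not
   smooth near [x] makes Leibniz equality the equality of tangent vectors. *)
Record tangent (x : M) (v : tvec) : Prop := Tangent {
  tangent_junk : forall f, ~ smooth_at x f -> v f = 0;
  tangent_germ : forall f g, smooth_at x f -> smooth_at x g ->
    (\forall z \near x, f z = g z) -> v f = v g;
  tangent_linear : forall (a : R[i]) f g, smooth_at x f -> smooth_at x g ->
    v (fun z => a * f z + g z) = a * v f + v g;
  tangent_leibniz : forall f g, smooth_at x f -> smooth_at x g ->
    v (fun z => f z * g z) = f x * v g + g x * v f }.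

Definition vfield := M -> tvec.

Definition fapp (X : vfield) (f : cfunc) : cfunc := fun x => X x f.

Definition fscale (f : cfunc) (X : vfield) : vfield := fun x g => f x * X x g.

Definition is_field (U : set M) (X : vfield) :=
  (forall x, U x -> tangent x (X x)) /\
  (forall (V : set M) f, open V -> V `<=` U -> smooth V f ->
     smooth V (fapp X f)).

Definition bracket (X Y : vfield) : vfield := fun x f =>
  if `[< smooth_at x f >] then X x (fapp Y f) - Y x (fapp X f) else 0.

Definition cform := M -> tvec -> tvec -> R[i].

Definition fpair (w : cform) (X Y : vfield) : cfunc := fun x => w x (X x) (Y x).

Record is_2form (w : cform) : Prop := Is2form {
  form_linear : forall x (a : R[i]) u v v', tangent x u -> tangent x v ->
    tangent x v' -> w x (fun f => a * u f + v f) v' = a * w x u v' + w x v v';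
  form_antisym : forall x u v, tangent x u -> tangent x v ->
    w x u v = - w x v u;
  form_smooth : forall (U : set M) X Y, open U -> is_field U X ->
    is_field U Y -> smooth U (fpair w X Y) }.

(* Cartan's formula for [dw (X, Y, Z)]. *)
Definition closed_form (w : cform) := forall (U : set M) X Y Z,
  open U -> is_field U X -> is_field U Y -> is_field U Z ->
  forall x, U x ->
    X x (fpair w Y Z) + Y x (fpair w Z X) + Z x (fpair w X Y)
    - fpair w (bracket X Y) Z x - fpair w (bracket Y Z) X x
    - fpair w (bracket Z X) Y x = 0.

Definition nondegenerate (w : cform) := forall x v, tangent x v ->
  (forall v', tangent x v' -> w x v v' = 0) -> v = 0.

(* [df /\ dg] *)
Definition dwedge (f g : cfunc) : cform := fun _ v v' => v f * v' g - v' f * v g.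

Definition eq_form_on (U : set M) (w w' : cform) := forall x, U x ->
  forall v v', tangent x v -> tangent x v' -> w x v v' = w' x v v'.

Definition indep_differentials (U : set M) m (x y : 'I_m -> cfunc) :=
  forall z, U z -> forall a b : 'I_m -> R[i],
    (forall v, tangent z v ->
       \sum_i a i * v (x i) + \sum_i b i * v (y i) = 0) ->
    (forall i, a i = 0) /\ (forall i, b i = 0).

Definition subbundle (P : M -> set tvec) := forall x0 : M,
  exists (U : set M) (r : nat) (e : 'I_r -> vfield),
  [/\ open U, U x0, forall j, is_field U (e j),
      forall z, U z -> forall v,
        P z v <-> exists a : 'I_r -> R[i],
          v = (fun f => \sum_j a j * e j z f)
    & forall z, U z -> forall a : 'I_r -> R[i],
        (forall f, \sum_j a j * e j z f = 0) -> forall j, a j = 0].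

Record polarized_symplectic (w : cform) (P : M -> set tvec) : Prop :=
  PolarizedSymplectic {
  pol_2form : is_2form w;
  pol_closed : closed_form w;
  pol_nondeg : nondegenerate w;
  pol_subbundle : subbundle P;
  (* nondegeneracy forces [n] to be even *)
  pol_local : forall x0 : M,
    exists (U : set M) (x y : 'I_(n./2) -> cfunc),
    [/\ open U, U x0,
        (forall i, smooth U (x i) /\ smooth U (y i)) /\
        indep_differentials U x y,
        eq_form_on U w (\sum_i dwedge (y i) (x i))
      & forall z, U z -> forall v,
          P z v <-> tangent z v /\ forall i, v (x i) = 0] }.

Definition bundle_sections (P : M -> set tvec) (U : set M) : set vfield :=
  [set X | is_field U X /\ forall x, U x -> P x (X x)].

Definition cauchy (A B : Type) (D : nmodType) (op : A -> B -> D)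
  (a : nat -> A) (b : nat -> B) : nat -> D :=
  fun k => \sum_(i < k.+1) op (a i) (b (k - i)%N).

Definition tfunc := nat -> cfunc.
Definition tfield := nat -> vfield.
Definition tform := nat -> cform.

Definition is_tfunc (U : set M) (f : tfunc) := forall k, smooth U (f k).
Definition is_tfield (U : set M) (X : tfield) := forall k, is_field U (X k).

Definition eq_tfield_on (U : set M) (X Y : tfield) :=
  forall k x, U x -> X k x = Y k x.

Definition tapp : tfield -> tfunc -> tfunc := cauchy fapp.
Definition tscale : tfunc -> tfield -> tfield := cauchy fscale.
Definition tbracket : tfield -> tfield -> tfield := cauchy bracket.
Definition tpair (w : tform) (X Y : tfield) : tfunc :=
  cauchy (fun (phi : vfield -> cfunc) Z => phi Z) (cauchy fpair w X) Y.
Definition tdwedge : tfunc -> tfunc -> tform := cauchy dwedge.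

(* [t ^ N * X] *)
Definition tpow (N : nat) (X : tfield) : tfield :=
  fun k => if (k < N)%N then 0 else X (k - N)%N.

(* [P U] is the module of sections over the open set [U]; sections over [U]
   being determined by their values on [U], [fsub_ext] is well-definedness. *)
Record formal_subbundle (P : set M -> set tfield) : Prop := FormalSubbundle {
  fsub_field : forall U X, open U -> P U X -> is_tfield U X;
  fsub_ext : forall U X Y, open U -> P U X -> eq_tfield_on U X Y -> P U Y;
  fsub0 : forall U, open U -> P U 0;
  fsubD : forall U X Y, open U -> P U X -> P U Y -> P U (X + Y);
  fsubZ : forall U f X, open U -> is_tfunc U f -> P U X -> P U (tscale f X);
  fsub_restrict : forall U V X, open U -> open V -> V `<=` U ->
    P U X -> P V X;
  fsub_glue : forall U X, open U ->
    (forall x, U x -> exists V : set M,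
       [/\ open V, V x, V `<=` U & P V X]) -> P U X;
  fsub_complete : forall U (S : nat -> tfield), open U ->
    (forall N, P U (S N)) ->
    (forall N, exists2 D, P U D & eq_tfield_on U (S N.+1 - S N) (tpow N D)) ->
    exists2 X, P U X &
      forall N, exists2 D, P U D & eq_tfield_on U (X - S N) (tpow N D);
  fsub_saturated : forall U X, open U -> is_tfield U X ->
    P U (tpow 1 X) -> P U X }.

Record formal_polarized_symplectic (w : tform) (P : set M -> set tfield)
  : Prop := FormalPolarizedSymplectic {
  fpol_2form : forall k, is_2form (w k);
  fpol_closed : forall k, closed_form (w k);
  fpol_nondeg : nondegenerate (w 0%N);
  fpol_subbundle : formal_subbundle P;
  (* formal coordinates: the differentials are independent modulo t *)
  fpol_local : forall x0 : M,
    exists (U : set M) (x y : 'I_(n./2) -> tfunc),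
    [/\ open U, U x0,
        (forall i, is_tfunc U (x i) /\ is_tfunc U (y i)) /\
        indep_differentials U (fun i => x i 0%N) (fun i => y i 0%N),
        (forall k, eq_form_on U (w k) (\sum_i tdwedge (y i) (x i) k))
      & forall (V : set M) X, open V -> V `<=` U ->
          P V X <-> is_tfield V X /\
            forall i k z, V z -> tapp X (x i) k z = 0] }.

End Tangent.

(* The sheaves [C_M] and [T] (or [C_M[[t]]] and [T[[t]]]) with the operations
   used to define a connection. *)
Record calculus (T : Type) := Calculus {
  fn : zmodType;
  vf : zmodType;
  fn_on : set T -> fn -> Prop;
  vf_on : set T -> vf -> Prop;
  fn_eq : set T -> fn -> fn -> Prop;
  vf_eq : set T -> vf -> vf -> Prop;
  vscale : fn -> vf -> vf;
  vapp : vf -> fn -> fn;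
  vbracket : vf -> vf -> vf }.

Definition smooth_calculus (R : realType) (n : nat) (M : smoothManifold R n) :
  calculus M :=
  @Calculus M (cfunc M : zmodType) (vfield M : zmodType)
    (@smooth R n M) (@is_field R n M)
    (fun U f g => forall x, U x -> f x = g x)
    (fun U X Y => forall x, U x -> X x = Y x)
    (@fscale R n M) (@fapp R n M) (@bracket R n M).

Definition formal_calculus (R : realType) (n : nat) (M : smoothManifold R n) :
  calculus M :=
  @Calculus M (tfunc M : zmodType) (tfield M : zmodType)
    (@is_tfunc R n M) (@is_tfield R n M)
    (fun U f g => forall k x, U x -> f k x = g k x)
    (@eq_tfield_on R n M)
    (@tscale R n M) (@tapp R n M) (@tbracket R n M).

Section Connections.
Variables (T : topologicalType) (K : calculus T).
Implicit Types (U : set T) (X Y Z : vf K) (f : fn K).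

(* [nabla X Y] is the covariant derivative of [Y] along [X]; [conn_local] says
   that it is a morphism of sheaves. *)
Record connection (nabla : vf K -> vf K -> vf K) : Prop := Connection {
  conn_on : forall U X Y, open U -> vf_on U X -> vf_on U Y ->
    vf_on U (nabla X Y);
  conn_local : forall U X X' Y Y', open U -> vf_on U X -> vf_on U X' ->
    vf_on U Y -> vf_on U Y' -> vf_eq U X X' -> vf_eq U Y Y' ->
    vf_eq U (nabla X Y) (nabla X' Y');
  conn_addl : forall U X X' Y, open U -> vf_on U X -> vf_on U X' ->
    vf_on U Y -> vf_eq U (nabla (X + X') Y) (nabla X Y + nabla X' Y);
  conn_addr : forall U X Y Y', open U -> vf_on U X -> vf_on U Y ->
    vf_on U Y' -> vf_eq U (nabla X (Y + Y')) (nabla X Y + nabla X Y');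
  conn_scalel : forall U f X Y, open U -> fn_on U f -> vf_on U X ->
    vf_on U Y -> vf_eq U (nabla (vscale f X) Y) (vscale f (nabla X Y));
  conn_leibniz : forall U f X Y, open U -> fn_on U f -> vf_on U X ->
    vf_on U Y -> vf_eq U (nabla X (vscale f Y))
                         (vscale (vapp X f) Y + vscale f (nabla X Y)) }.

Record P_symplectic_connection (w : vf K -> vf K -> fn K)
  (P : set T -> set (vf K)) (nabla : vf K -> vf K -> vf K) : Prop :=
  PSymplecticConnection {
  psc_connection : connection nabla;
  psc_form : forall U X Y Z, open U -> vf_on U X -> vf_on U Y -> vf_on U Z ->
    fn_eq U (vapp X (w Y Z)) (w (nabla X Y) Z + w Y (nabla X Z));
  psc_torsion : forall U X Y, open U -> vf_on U X -> vf_on U Y ->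
    vf_eq U (nabla X Y - nabla Y X) (vbracket X Y);
  psc_preserves : forall U X Y, open U -> vf_on U X -> P U Y ->
    P U (nabla X Y);
  psc_flat : forall U X Y Z, open U -> P U X -> P U Y -> P U Z ->
    vf_eq U (nabla X (nabla Y Z) - nabla Y (nabla X Z)
             - nabla (vbracket X Y) Z) 0 }.

End Connections.

(* Main.v *)
(* In Darboux coordinates [x_i, y_i], the flat connection whose parallel fields
   are the coordinate ones, i.e. the connection with
   [dx_i (nabla_X Y) = X (Y x_i)] and [dy_i (nabla_X Y) = X (Y y_i)], is
   P-symplectic.  Preserving [w] and [P] without torsion is an affine condition,
   so a partition of unity glues the local connections into a global one.
   Flatness on [P] along [P] is then automatic: [P] is Lagrangian, so any
   torsion-free connection preserving [w] and [P] satisfies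
   [w (nabla_X Y, Z) = X (w (Y, Z)) - w (Y, [X, Z])] for [X], [Y] in [P], and
   therefore agrees there with the flat local connection.

   The coordinate fields exist and are smooth without the inverse function
   theorem: nondegeneracy makes [v |-> (v x_i, v y_i)] injective on tangent
   vectors, so the Jacobian matrix in any chart is invertible, and the coordinate
   fields are read off its inverse.  A formal field with prescribed components is
   found by solving for its coefficients order by order.

   A polarized symplectic manifold is a formal one with constant series, and its
   connection is the order zero part of a formal one. *)
Require Import Defs.
From mathcomp Require Import all_boot all_order all_algebra.
From mathcomp Require Import complex.
From mathcomp Require Import all_classical all_reals all_analysis.
From mathcomp Require Import ring lra.

Set Implicit Arguments.
Unset Strict Implicit.
Unset Printing Implicit Defensive.

Import Order.TTheory GRing.Theory Num.Theory numFieldNormedType.Exports.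

Local Open Scope classical_set_scope.
Local Open Scope ring_scope.
Local Open Scope complex_scope.

(** * Smooth functions on open subsets of R^n *)

(** Flatness is quadratic in the connection, so an average of flat connections need not be flat;
    this is why it has to come from uniqueness on [P] along [P] and not from gluing. Sections are
    total functions, so each local connection is built as a total operation returning 0 off its
    chart, and weighted sums over all charts then make sense at every point. The formal operations
    are Cauchy products: their identities reduce to reordering multiple sums, and equality of formal
    fields is tested on coordinate functions, where the coefficient of order [k] meets only the
    order-zero coordinates once the lower ones are known. The passage from [P[[t]]] back to [P]
    needs care because curvature composes the connection with itself while only order zero is
    kept. *)

Section Flat.
Variable R : realType.

(* [flat 0] is the standard smooth function vanishing exactly on [s <= 0]; the
   other members of the family are needed to express its derivatives. *)
Definition flat (m : nat) (s : R) : R :=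
  if 0 < s then s^-1 ^+ m * expR (- s^-1) else 0.

(** The exponential of [s^-1] dominates the term of degree [m.+1] of its power series, one power
    more than the prefactor, so a factor [s] is left over. *)
Lemma flat_le m (s : R) : `|flat m s| <= m.+1`!%:R * `|s|.
Proof.
rewrite /flat; case: ifP => [s0|_]; last by rewrite normr0 mulr_ge0.
have si0 : 0 < s^-1 by rewrite invr_gt0.
rewrite gtr0_norm; last by rewrite mulr_gt0 ?exprn_gt0 ?expR_gt0.
rewrite gtr0_norm// expRN ler_pdivrMr ?expR_gt0//.
have := @expR_ge1Dxn _ s^-1 m (ltW si0).
move=> H; have {}H : s^-1 ^+ m.+1 / m.+1`!%:R <= expR s^-1.
  by apply: le_trans H; rewrite lerDr.
rewrite ler_pdivrMr ?ltr0n ?fact_gt0// in H.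
have := ler_wpM2r (ltW s0) H; rewrite exprSr mulfVK ?gt_eqF// => H2.
by apply: (le_trans H2); rewrite le_eqVlt; apply/orP; left; apply/eqP; ring.
Qed.

Lemma is_derive_flat m (s : R) :
  is_derive s 1 (flat m) (flat m.+2 s - m%:R * flat m.+1 s).
Proof.
have [s0|s0|->] := ltgtP s 0.
- rewrite {2 3}/flat ltNge (ltW s0)/= mulr0 subr0.
  apply: (@near_eq_is_derive _ _ _ (cst 0)).
  near=> t; rewrite /flat ltNge (_ : t <= 0)//.
  near: t; near do apply: ltW; apply: (@open_nbhs_nbhs _ s [set t : R | t < 0]).
  by split=> //; exact: open_lt.
- apply: (@near_eq_is_derive R R R (fun t : R => t^-1 ^+ m * expR (- t^-1))).
    near=> t; rewrite /flat (_ : 0 < t)//.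
    near: t; apply: (@open_nbhs_nbhs _ s [set t : R | 0 < t]).
    by split=> //; exact: open_gt.
  have dV : is_derive s 1 (fun t : R => t^-1) (- s ^- 2).
    apply: is_derive_eq; first by apply: is_deriveV; rewrite gt_eqF.
    by rewrite /GRing.scale/= mulr1.
  have dE : is_derive s 1 (fun t : R => expR (- t^-1)) (expR (- s^-1) * s ^- 2).
    have dN : is_derive s 1 (fun t : R => - t^-1) (- - s ^- 2) by apply: is_deriveN.
    rewrite opprK in dN.
    exact: (@is_derive1_comp _ expR (fun t : R => - t^-1) s _ _ (is_derive_expR _) dN).
  have dX : is_derive s 1 (fun t : R => t^-1 ^+ m) (m%:R * s^-1 ^+ m.-1 * - s ^- 2).
    by have := @is_deriveX _ _ (fun t : R => t^-1) m s 1 _ dV; rewrite exprfctE.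
  apply: (is_derive_eq (is_deriveM dX dE)).
  rewrite /flat s0 /GRing.scale/=.
  case: (m) => [|k].
    by rewrite -!exprVn /=; ring.
  by rewrite -!exprVn /= !exprS; ring.
- rewrite /flat ltxx mulr0 subr0.
  have H : (fun h : R => h^-1 *: ((flat m \o shift 0) (h *: 1) - flat m 0))
      @ 0^' --> (0:R).
    (* The difference quotient of [flat m] at 0 is [flat m.+1] itself, and [flat_le] sends it to
       0. *)
    rewrite (_ : (fun _ => _) = flat m.+1).
      apply/cvgr0Pnorm_lt => e e0; near=> h.
      apply: le_lt_trans (flat_le _ _) _.
      rewrite mulrC -ltr_pdivlMr ?ltr0n ?fact_gt0//.
      near: h; apply: dnbhs0_lt.
      by rewrite divr_gt0// ltr0n fact_gt0.
    apply/funext => h /=; rewrite /flat ltxx subr0 addr0 /GRing.scale/= mulr1.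
    by case: ifP => _; rewrite ?mulr0// exprS mulrA.
  constructor; first by apply/cvg_ex; exists 0.
  exact/cvg_lim.
Unshelve. all: by end_near. Qed.

End Flat.

Lemma near_eq_continuous (T U : topologicalType) (f g : T -> U) x :
  (\near x, f x = g x) -> {for x, continuous f} -> {for x, continuous g}.
Proof.
move=> fg cf; have : f @ x --> g x by rewrite -(nbhs_singleton fg); exact: cf.
by apply: cvg_trans; exact: near_eq_cvg.
Qed.

Section Smoothness.
Variables (R : realType) (n : nat).
Implicit Types (D : set 'rV[R]_n) (f g : 'rV[R]_n -> R).

(** The partial derivatives are total functions, so [Ck k D] is a family of conditions imposed
    separately at each point of [D]. All locality statements below rest on this. *)
Lemma Ck_pointwise k D f : Ck k D f <-> forall u, D u -> Ck k [set u] f.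
Proof.
elim: k f => [|k IH] f /=.
  split=> [H u Du v -> |H u Du]; [exact: H|exact: (H u)].
split=> [[H1 H2] u Du|H].
  split=> [v i -> |i]; first exact: H1.
  by have /IH := H2 i; apply.
split=> [u i Du|i]; first by have [+ _] := H u Du; apply.
by apply/IH => u Du; have [_] := H u Du; apply.
Qed.

Lemma Ck_eq k D f g : open D -> (forall u, D u -> f u = g u) ->
  Ck k D f -> Ck k D g.
Proof.
move=> oD; have nfg (h h' : 'rV[R]_n -> R) : (forall u, D u -> h u = h' u) ->
    forall u, D u -> \near u, h u = h' u.
  by move=> hh' u Du; near=> v; apply: hh'; near: v; exact: open_nbhs_nbhs.
elim: k f g => [|k IH] f g fg /=.
  by move=> H u Du; apply: near_eq_continuous (H u Du); exact: nfg.
move=> [H1 H2]; split=> [u i Du|i].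
  exact: (near_eq_derivable (nfg f g fg u Du) (H1 u i Du)).
apply: (IH ('D_(delta_mx 0 i) f)) (H2 i) => u Du.
exact: (near_eq_derive _ (nfg f g fg u Du)).
Unshelve. all: by end_near. Qed.

Lemma smooth_rn_pointwise D f :
  smooth_rn D f <-> forall u, D u -> smooth_rn [set u] f.
Proof.
split=> [H u Du k|H k]; first exact: (Ck_pointwise k D f).1.
by apply/Ck_pointwise => u Du; exact: H.
Qed.

Lemma smooth_rn_eq D f g : open D -> (forall u, D u -> f u = g u) ->
  smooth_rn D f -> smooth_rn D g.
Proof. by move=> oD fg H k; exact: Ck_eq (H k). Qed.

Lemma smooth_rn_derive D f (i : 'I_n) : smooth_rn D f ->
  smooth_rn D ('D_(delta_mx 0 i) f).
Proof. by move=> H k; have [_ H2] := H k.+1; exact: H2. Qed.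

Lemma smooth_rn_derivable D f u (i : 'I_n) : smooth_rn D f -> D u ->
  derivable f u (delta_mx 0 i).
Proof. by move=> H Du; have [H1 _] := H 1%N; exact: H1. Qed.

Lemma smooth_rn_cst D c : smooth_rn D (fun=> c).
Proof.
move=> k; elim: k c => [|k IH] c /=; first by move=> u _; exact: cst_continuous.
split=> [u i _|i]; first exact: derivable_cst.
by rewrite (_ : derive _ ^~ _ = fun=> 0)//; apply/funext => u; exact: derive_cst.
Qed.

(** Only directional derivatives of [f] are at hand, so [f] is restricted to the line through [u]
    along [v], and the chain rule of one variable applies at parameter 0. *)
Lemma is_derive_comp_line f (h : R -> R) (u v : 'rV[R]_n) a b :
  is_derive u v f a -> is_derive (f u) 1 h b ->
  is_derive u v (h \o f) (b * a).
Proof.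
set F := fun t : R => f (t *: v + u) => -[df <-] dh.
have F0 : F 0 = f u by rewrite /F scale0r add0r.
have e (g : 'rV[R]_n -> R) : 'D_v g u = 'D_1 (fun t : R => g (t *: v + u)) 0.
  rewrite /derive; set g1 := fun h => h^-1 *: _; set g2 := fun h => h^-1 *: _.
  suff -> : g1 = g2 by [].
  by apply/funext => t; rewrite /g1 /g2 /= scale0r add0r addr0 /GRing.scale/= mulr1.
have dF : is_derive (0:R) 1 F ('D_v f u).
  by constructor; [exact: (derivable1P f u v).1|rewrite e].
have [dhF hF] : is_derive (0:R) 1 (h \o F) (b * 'D_v f u).
  by apply: is_derive1_comp; rewrite F0.
by constructor; [exact: (derivable1P (h \o f) u v).2|rewrite e].
Qed.

(* A class of functions closed under partial derivatives, hence consisting of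
   smooth functions. *)
Inductive smooth_closure D : ('rV[R]_n -> R) -> Prop :=
| closure_base f : smooth_rn D f -> smooth_closure D f
| closure_add f g : smooth_closure D f -> smooth_closure D g ->
    smooth_closure D (fun u => f u + g u)
| closure_mul f g : smooth_closure D f -> smooth_closure D g ->
    smooth_closure D (fun u => f u * g u)
| closure_inv f : smooth_closure D f -> (forall u, D u -> f u != 0) ->
    smooth_closure D (fun u => (f u)^-1)
| closure_flat m f : smooth_closure D f ->
    smooth_closure D (fun u => flat m (f u)).

Lemma closure_derive D f : smooth_closure D f ->
  (forall u, D u -> {for u, continuous f}) /\
  forall i, exists2 g, smooth_closure D g &
    forall u, D u -> is_derive u (delta_mx 0 i) f (g u).
Proof.
elim=> {f} [f H|f g _ [cf df] _ [cg dg]|f g sf [cf df] sg [cg dg]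
           |f sf [cf df] f0|m f sf [cf df]].
- split=> [u Du|i]; first by have := H 0%N; apply.
  exists ('D_(delta_mx 0 i) f); first exact/closure_base/smooth_rn_derive.
  by move=> u Du; apply: derivableP; exact: smooth_rn_derivable Du.
- split=> [u Du|i]; first by apply: continuousD; [exact: cf|exact: cg].
  have [f' sf' f'E] := df i; have [g' sg' g'E] := dg i.
  exists (fun u => f' u + g' u); first exact: closure_add.
  by move=> u Du; apply: is_deriveD; [exact: f'E|exact: g'E].
- split=> [u Du|i]; first by apply: continuousM; [exact: cf|exact: cg].
  have [f' sf' f'E] := df i; have [g' sg' g'E] := dg i.
  exists (fun u => f u * g' u + g u * f' u).
    by apply: closure_add; apply: closure_mul.
  by move=> u Du; apply: is_deriveM; [exact: f'E|exact: g'E].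
- split=> [u Du|i]; first by apply: continuousV; [exact: f0|exact: cf].
  have [f' sf' f'E] := df i.
  (* The class has no constructor for opposites: the sign enters as a constant factor. *)
  exists (fun u => (-1) * ((f u)^-1 * (f u)^-1 * f' u)).
    apply: closure_mul; first exact/closure_base/smooth_rn_cst.
    by do 2?apply: closure_mul => //; exact: closure_inv.
  move=> u Du; have dV : is_derive (f u) 1 (fun t : R => t^-1) (- f u ^- 2).
    apply: is_derive_eq; first by apply: is_deriveV; rewrite f0.
    by rewrite /GRing.scale/= mulr1.
  rewrite (_ : -1 * _ = - f u ^- 2 * f' u); last by rewrite -exprVn; ring.
  exact: (is_derive_comp_line (f'E u Du) dV).
- split=> [u Du|i].
    apply: (@continuous_comp _ _ _ f (flat m)); first exact: cf.
    have [/derivable1_diffP + _] := is_derive_flat m (f u).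
    exact: differentiable_continuous.
  have [f' sf' f'E] := df i.
  exists (fun u => (flat m.+2 (f u) + (- m%:R) * flat m.+1 (f u)) * f' u).
    apply: closure_mul => //; apply: closure_add; first exact: closure_flat.
    apply: closure_mul; last exact: closure_flat.
    exact/closure_base/smooth_rn_cst.
  move=> u Du; rewrite mulNr.
  exact/(is_derive_comp_line (f'E u Du))/is_derive_flat.
Qed.

(** The induction on [k] runs over the whole class at once: a partial derivative stays in the class,
    so the induction hypothesis applies to it directly. *)
Lemma closure_smooth D f : open D -> smooth_closure D f -> smooth_rn D f.
Proof.
move=> oD + k; elim: k f => [|k IH] f sf /=; first by have [] := closure_derive sf.
have [_ H] := closure_derive sf; split=> [u i Du|i].
  by have [g _ /(_ u Du)[]] := H i.
have [g sg E] := H i; apply: Ck_eq (IH _ sg) => // u Du.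
by have [_ ->] := E u Du.
Qed.

Lemma smooth_rnD D f g : open D -> smooth_rn D f -> smooth_rn D g ->
  smooth_rn D (fun u => f u + g u).
Proof.
by move=> oD sf sg; apply: closure_smooth => //; apply: closure_add; apply: closure_base.
Qed.

Lemma smooth_rnM D f g : open D -> smooth_rn D f -> smooth_rn D g ->
  smooth_rn D (fun u => f u * g u).
Proof.
by move=> oD sf sg; apply: closure_smooth => //; apply: closure_mul; apply: closure_base.
Qed.

Lemma smooth_rnV D f : open D -> smooth_rn D f -> (forall u, D u -> f u != 0) ->
  smooth_rn D (fun u => (f u)^-1).
Proof.
by move=> oD sf f0; apply: closure_smooth => //; apply: closure_inv => //; apply: closure_base.
Qed.

Lemma smooth_rn_flat m D f : open D -> smooth_rn D f ->
  smooth_rn D (fun u => flat m (f u)).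
Proof.
by move=> oD sf; apply: closure_smooth => //; apply: closure_flat; apply: closure_base.
Qed.

End Smoothness.

(** * Complex-valued smooth functions on subsets of R^n *)

Section ComplexSmoothness.
Variables (R : realType) (n : nat).
Implicit Types (D : set 'rV[R]_n) (F G : 'rV[R]_n -> R[i]).

Definition csmooth_rn D F :=
  smooth_rn D (fun u => complex.Re (F u)) /\ smooth_rn D (fun u => complex.Im (F u)).

Lemma csmooth_rn_pointwise D F :
  csmooth_rn D F <-> forall u, D u -> csmooth_rn [set u] F.
Proof.
split=> [[rF iF] u Du|H].
  split; first exact: (smooth_rn_pointwise D _).1 rF u Du.
  exact: (smooth_rn_pointwise D _).1 iF u Du.
by split; apply/smooth_rn_pointwise => u /H[].
Qed.

Lemma csmooth_rn_eq D F G : open D -> (forall u, D u -> F u = G u) ->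
  csmooth_rn D F -> csmooth_rn D G.
Proof.
move=> oD FG [rF iF]; split.
  by apply: smooth_rn_eq rF => // u /FG ->.
by apply: smooth_rn_eq iF => // u /FG ->.
Qed.

Lemma csmooth_rn_cst D c : csmooth_rn D (fun=> c).
Proof. by split; exact: smooth_rn_cst. Qed.

Lemma ReD (a b : R[i]) : complex.Re (a + b) = complex.Re a + complex.Re b.
Proof. by case: a; case: b. Qed.

Lemma ImD (a b : R[i]) : complex.Im (a + b) = complex.Im a + complex.Im b.
Proof. by case: a; case: b. Qed.

Lemma ReM (a b : R[i]) : complex.Re (a * b) =
  complex.Re a * complex.Re b + (-1) * (complex.Im a * complex.Im b).
Proof. by case: a => ? ?; case: b => ? ?; rewrite mulN1r. Qed.

Lemma ImM (a b : R[i]) : complex.Im (a * b) =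
  complex.Re a * complex.Im b + complex.Im a * complex.Re b.
Proof. by case: a; case: b. Qed.

Lemma csmooth_rnD D F G : open D -> csmooth_rn D F -> csmooth_rn D G ->
  csmooth_rn D (fun u => F u + G u).
Proof.
move=> oD [rF iF] [rG iG]; split.
  by under eq_fun do rewrite ReD; exact: smooth_rnD.
by under eq_fun do rewrite ImD; exact: smooth_rnD.
Qed.

Lemma csmooth_rnM D F G : open D -> csmooth_rn D F -> csmooth_rn D G ->
  csmooth_rn D (fun u => F u * G u).
Proof.
move=> oD [rF iF] [rG iG]; split.
  under eq_fun do rewrite ReM.
  apply: smooth_rnD => //; do ?apply: smooth_rnM => //; exact: smooth_rn_cst.
by under eq_fun do rewrite ImM; apply: smooth_rnD => //; exact: smooth_rnM.
Qed.

Lemma csmooth_rnV D F : open D -> csmooth_rn D F -> (forall u, D u -> F u != 0) ->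
  csmooth_rn D (fun u => (F u)^-1).
Proof.
move=> oD [rF iF] F0.
(* [N] is the squared modulus; the inverse of [F] is its conjugate divided by [N]. *)
pose N u := complex.Re (F u) * complex.Re (F u) + complex.Im (F u) * complex.Im (F u).
have sN : smooth_rn D (fun u => (N u)^-1).
  apply: smooth_rnV => //; first by apply: smooth_rnD => //; apply: smooth_rnM.
  move=> u /F0; apply: contra; rewrite /N -!expr2 paddr_eq0 ?sqr_ge0//.
  by rewrite !sqrf_eq0 eq_complex.
split.
  rewrite (_ : (fun _ => _) = fun u => complex.Re (F u) * (N u)^-1).
    exact: smooth_rnM.
  by apply/funext => u; rewrite /N -!expr2; case: (F u).
rewrite (_ : (fun _ => _) = fun u => (-1) * (complex.Im (F u) * (N u)^-1)).
  by apply: smooth_rnM => //; [exact: smooth_rn_cst|exact: smooth_rnM].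
by apply/funext => u; rewrite /N -!expr2 mulN1r; case: (F u) => a b.
Qed.

Lemma csmooth_rn_sum D (I : Type) (r : seq I) (P : pred I)
    (F : I -> 'rV[R]_n -> R[i]) :
  open D -> (forall i, P i -> csmooth_rn D (F i)) ->
  csmooth_rn D (fun u => \sum_(i <- r | P i) F i u).
Proof.
move=> oD sF; elim: r => [|i r IH].
  by under eq_fun do rewrite big_nil; exact: csmooth_rn_cst.
have [Pi|/negbTE nPi] := boolP (P i).
  by under eq_fun do rewrite big_cons Pi; apply: csmooth_rnD => //; exact: sF.
by under eq_fun do rewrite big_cons nPi.
Qed.

Lemma csmooth_rn_prod D (I : Type) (r : seq I) (F : I -> 'rV[R]_n -> R[i]) :
  open D -> (forall i, csmooth_rn D (F i)) ->
  csmooth_rn D (fun u => \prod_(i <- r) F i u).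
Proof.
move=> oD sF; elim: r => [|i r IH].
  by under eq_fun do rewrite big_nil; exact: csmooth_rn_cst.
by under eq_fun do rewrite big_cons; exact: csmooth_rnM.
Qed.

Lemma csmooth_rn_det D m (A : 'rV[R]_n -> 'M[R[i]]_m) : open D ->
  (forall i j, csmooth_rn D (fun u => A u i j)) ->
  csmooth_rn D (fun u => \det (A u)).
Proof.
move=> oD sA; apply: csmooth_rn_sum => // s _.
by apply: csmooth_rnM => //; [exact: csmooth_rn_cst|exact: csmooth_rn_prod].
Qed.

(** Cramer's rule: each entry of the inverse is a cofactor, polynomial in the entries, divided by
    the determinant. *)
Lemma csmooth_rn_invmx D m (A : 'rV[R]_n -> 'M[R[i]]_m) i j : open D ->
  (forall i j, csmooth_rn D (fun u => A u i j)) ->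
  (forall u, D u -> A u \in unitmx) ->
  csmooth_rn D (fun u => invmx (A u) i j).
Proof.
move=> oD sA uA.
have sV : csmooth_rn D (fun u => (\det (A u))^-1 * \adj (A u) i j).
  apply: csmooth_rnM => //.
    by apply: csmooth_rnV => //; exact: csmooth_rn_det.
  rewrite (_ : (fun u => _) = fun u => cofactor (A u) j i); last first.
    by apply/funext => u; rewrite mxE.
  apply: csmooth_rnM => //; first exact: csmooth_rn_cst.
  apply: csmooth_rn_det => // k l.
  rewrite (_ : (fun u => _) = fun u => A u (lift j k) (lift i l)) //.
  by apply/funext => u; rewrite !mxE.
by apply: (csmooth_rn_eq oD _ sV) => u Du; rewrite /invmx (uA u Du) [RHS]mxE.
Qed.

Definition cderive (j : 'I_n) F (u : 'rV[R]_n) : R[i] :=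
  ('D_(delta_mx 0 j) (fun u => complex.Re (F u)) u)
  +i* ('D_(delta_mx 0 j) (fun u => complex.Im (F u)) u).

Lemma csmooth_rn_cderive D j F : csmooth_rn D F -> csmooth_rn D (cderive j F).
Proof. by move=> [rF iF]; split; exact: smooth_rn_derive. Qed.

Lemma near_eq_cderive j F G u : (\near u, F u = G u) -> cderive j F u = cderive j G u.
Proof.
by move=> FG; congr (_ +i* _); apply: near_eq_derive; near=> v; apply: congr1; near: v.
Unshelve. all: by end_near. Qed.

Lemma cderive_cst j c u : cderive j (fun=> c) u = 0.
Proof. by rewrite /cderive !derive_cst. Qed.

Lemma cderiveD D j F G u : csmooth_rn D F -> csmooth_rn D G -> D u ->
  cderive j (fun u => F u + G u) u = cderive j F u + cderive j G u.
Proof.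
move=> [rF iF] [rG iG] Du; rewrite /cderive.
rewrite (_ : (fun _ => complex.Re _) =
  (fun u => complex.Re (F u)) + (fun u => complex.Re (G u))); last first.
  by apply/funext => v; rewrite ReD.
rewrite (_ : (fun _ => complex.Im (_ + _)) =
  (fun u => complex.Im (F u)) + (fun u => complex.Im (G u))); last first.
  by apply/funext => v; rewrite ImD.
by rewrite !deriveD//; exact: smooth_rn_derivable Du.
Qed.

Lemma cderiveM D j F G u : csmooth_rn D F -> csmooth_rn D G -> D u ->
  cderive j (fun u => F u * G u) u = F u * cderive j G u + G u * cderive j F u.
Proof.
move=> [rF iF] [rG iG] Du; rewrite /cderive.
set a := fun u => complex.Re (F u); set b := fun u => complex.Im (F u).
set c := fun u => complex.Re (G u); set d := fun u => complex.Im (G u).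
have [da db] : derivable a u (delta_mx 0 j) /\ derivable b u (delta_mx 0 j).
  by split; exact: smooth_rn_derivable Du.
have [dc dd] : derivable c u (delta_mx 0 j) /\ derivable d u (delta_mx 0 j).
  by split; exact: smooth_rn_derivable Du.
rewrite (_ : (fun _ => complex.Re (_ * _)) = a * c - b * d); last first.
  by apply/funext => v; rewrite ReM mulN1r.
rewrite (_ : (fun _ => complex.Im (_ * _)) = a * d + b * c); last first.
  by apply/funext => v; rewrite ImM.
have -> : 'D_(delta_mx 0 j) (a * c - b * d) u =
    a u * 'D_(delta_mx 0 j) c u + c u * 'D_(delta_mx 0 j) a u
    - (b u * 'D_(delta_mx 0 j) d u + d u * 'D_(delta_mx 0 j) b u).
  by rewrite (deriveB (derivableM da dc) (derivableM db dd)) (deriveM da dc)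
    (deriveM db dd).
have -> : 'D_(delta_mx 0 j) (a * d + b * c) u =
    a u * 'D_(delta_mx 0 j) d u + d u * 'D_(delta_mx 0 j) a u
    + (b u * 'D_(delta_mx 0 j) c u + c u * 'D_(delta_mx 0 j) b u).
  by rewrite (deriveD (derivableM da dd) (derivableM db dc)) (deriveM da dd)
    (deriveM db dc).
move: ('D_(delta_mx 0 j) a u) ('D_(delta_mx 0 j) b u)
  ('D_(delta_mx 0 j) c u) ('D_(delta_mx 0 j) d u) => a' b' c' d'.
have -> : F u = a u +i* b u by rewrite /a /b; case: (F u).
have -> : G u = c u +i* d u by rewrite /c /d; case: (G u).
move: (a u) (b u) (c u) (d u) => {da db dc dd} ar br cr dr.
apply/eqP; rewrite eq_complex /=.
by apply/andP; split; apply/eqP; ring.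
Qed.

End ComplexSmoothness.

(** * Smooth functions and tangent vectors on a manifold *)

Section SmoothFunctions.
Variables (R : realType) (n : nat) (M : smoothManifold R n).
Implicit Types (c d : chart R n M) (U V : set M) (f g : cfunc M) (x : M).

Definition chart_image c U := cmap c @` (cdom c `&` U).

(** A chart only promises that the image of its whole domain is open; the image of a smaller open
    set is the preimage of that set under the continuous [cinv]. *)
Lemma open_chart_image c U : open U -> open (chart_image c U).
Proof.
move=> oU.
have -> : chart_image c U = (cmap c @` cdom c) `&` (cinv c @^-1` U).
  apply/seteqP; split=> [u [x [cx Ux] <-]|u [[x cx <-]]] /=.
    by rewrite cmapK//; split=> //; exists x.
  by rewrite cmapK// => Ux; exists x.
have oc : open (cmap c @` cdom c) by exact: cimg_open.
apply: (iffLR (continuous_inP (cinv c) oc)) => //.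
rewrite -continuous_open_subspace//; exact: cinv_continuous.
Qed.

Lemma chart_imageK c U u : chart_image c U u ->
  [/\ cdom c (cinv c u), U (cinv c u) & cmap c (cinv c u) = u].
Proof. by move=> [x [cx Ux] <-]; rewrite cmapK. Qed.

Lemma chart_image_in c U x : cdom c x -> U x -> chart_image c U (cmap c x).
Proof. by move=> cx Ux; exists x. Qed.

Lemma smoothE U f : smooth U f <->
  forall c, atlas c -> csmooth_rn (chart_image c U) (fun u => f (cinv c u)).
Proof. by []. Qed.

(** Smoothness is tested point by point, by [csmooth_rn_pointwise], so any set containing the point
    can serve as [V]; restriction to an arbitrary subset follows. *)
Lemma smooth_local U f :
  (forall x, U x -> exists2 V, V x & smooth V f) -> smooth U f.
Proof.
move=> H; apply/smoothE => c ac; apply/csmooth_rn_pointwise => u.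
move=> [x [cx Ux] <-]; have [V Vx /smoothE/(_ c ac)] := H x Ux.
by move/csmooth_rn_pointwise; apply; exists x.
Qed.

Lemma smooth_sub U V f : V `<=` U -> smooth U f -> smooth V f.
Proof. by move=> VU sf; apply: smooth_local => x /VU Ux; exists U. Qed.

Lemma smooth_eq U f g : open U -> (forall x, U x -> f x = g x) ->
  smooth U f -> smooth U g.
Proof.
move=> oU fg /smoothE sf; apply/smoothE => c ac.
apply: (csmooth_rn_eq (open_chart_image oU) _ (sf c ac)) => u.
by move=> /chart_imageK[_ /fg].
Qed.

Lemma smooth_cst U a : smooth U (fun=> a : R[i]).
Proof. by apply/smoothE => c _; exact: csmooth_rn_cst. Qed.

Lemma smoothD U f g : open U -> smooth U f -> smooth U g ->
  smooth U (fun x => f x + g x).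
Proof.
move=> oU /smoothE sf /smoothE sg; apply/smoothE => c ac.
by apply: csmooth_rnD; [exact: open_chart_image|exact: sf|exact: sg].
Qed.

Lemma smoothM U f g : open U -> smooth U f -> smooth U g ->
  smooth U (fun x => f x * g x).
Proof.
move=> oU /smoothE sf /smoothE sg; apply/smoothE => c ac.
by apply: csmooth_rnM; [exact: open_chart_image|exact: sf|exact: sg].
Qed.

Lemma smooth_scale U a f : open U -> smooth U f -> smooth U (fun x => a * f x).
Proof. by move=> oU sf; apply: smoothM => //; exact: smooth_cst. Qed.

Lemma smoothB U f g : open U -> smooth U f -> smooth U g ->
  smooth U (fun x => f x - g x).
Proof.
move=> oU sf sg; rewrite (_ : (fun x => _) = fun x => f x + (-1) * g x).
  by apply: smoothD => //; exact: smooth_scale.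
by apply/funext => x; rewrite mulN1r.
Qed.

Lemma smooth_sum U (I : Type) (r : seq I) (P : pred I) (F : I -> cfunc M) :
  open U -> (forall i, P i -> smooth U (F i)) ->
  smooth U (fun x => \sum_(i <- r | P i) F i x).
Proof.
move=> oU sF; apply/smoothE => c ac.
by apply: csmooth_rn_sum; [exact: open_chart_image|move=> i /sF/smoothE/(_ c ac)].
Qed.

Lemma smooth_prod U (I : Type) (r : seq I) (F : I -> cfunc M) :
  open U -> (forall i, smooth U (F i)) ->
  smooth U (fun x => \prod_(i <- r) F i x).
Proof.
move=> oU sF; apply/smoothE => c ac.
by apply: csmooth_rn_prod; [exact: open_chart_image|move=> i; exact: (smoothE U _).1].
Qed.

Lemma smooth_at2 x f g : smooth_at x f -> smooth_at x g ->
  exists U, [/\ open U, U x, smooth U f & smooth U g].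
Proof.
move=> [U [oU Ux sf]] [V [oV Vx sg]]; exists (U `&` V); split.
- exact: openI.
- by [].
- by apply: smooth_sub sf => z [].
- by apply: smooth_sub sg => z [].
Qed.

Lemma smooth_at_cst x a : smooth_at x (fun=> a : R[i]).
Proof. by exists setT; split=> //; [exact: openT|exact: smooth_cst]. Qed.

Lemma smooth_atD x f g : smooth_at x f -> smooth_at x g ->
  smooth_at x (fun z => f z + g z).
Proof.
by move=> sf /(smooth_at2 sf)[U [oU Ux {}sf sg]]; exists U; split=> //; exact: smoothD.
Qed.

Lemma smooth_atM x f g : smooth_at x f -> smooth_at x g ->
  smooth_at x (fun z => f z * g z).
Proof.
by move=> sf /(smooth_at2 sf)[U [oU Ux {}sf sg]]; exists U; split=> //; exact: smoothM.
Qed.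

Lemma near_open (T : topologicalType) (P : set T) (x : T) :
  (\forall z \near x, P z) -> exists V : set T, [/\ open V, V x & forall z, V z -> P z].
Proof.
by move=> xP; have : nbhs x P by []; rewrite nbhsE => -[V [oV Vx] VP]; exists V.
Qed.

Definition chart_coord c (j : 'I_n) : cfunc M := fun z => (cmap c z 0 j)%:C.

Lemma smooth_chart_coord c j : atlas c -> smooth (cdom c) (chart_coord c j).
Proof.
move=> ac; apply/smoothE => d ad; split; last exact: smooth_rn_cst.
exact: atlas_compat.
Qed.

(** The value 0 on functions that are not smooth at [x] is the one demanded by [tangent_junk]. *)
Definition partial c (j : 'I_n) x : tvec M := fun f =>
  if `[< smooth_at x f >] then cderive j (fun u => f (cinv c u)) (cmap c x) else 0.

Lemma partialE c j x f : smooth_at x f ->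
  partial c j x f = cderive j (fun u => f (cinv c u)) (cmap c x).
Proof. by move=> sf; rewrite /partial asboolT. Qed.

Lemma near_eq_chart c x f g : cdom c x -> (\near x, f x = g x) ->
  \forall u \near cmap c x, f (cinv c u) = g (cinv c u).
Proof.
move=> cx /near_open[V [oV Vx fg]].
have := open_nbhs_nbhs (conj (open_chart_image oV) (chart_image_in cx Vx)).
by apply: filterS => u /chart_imageK[_ /fg].
Qed.

Lemma tangent_partial c j x : atlas c -> cdom c x -> tangent x (partial c j x).
Proof.
move=> ac cx.
have key f g : smooth_at x f -> smooth_at x g -> exists D,
    [/\ D (cmap c x), csmooth_rn D (fun u => f (cinv c u)) &
        csmooth_rn D (fun u => g (cinv c u))].
  move=> sf /(smooth_at2 sf)[U [oU Ux /smoothE/(_ c ac) {}sf /smoothE/(_ c ac) sg]].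
  by exists (chart_image c U); split=> //; exact: chart_image_in.
split.
- by move=> f nf; rewrite /partial asboolF.
- move=> f g sf sg fg; rewrite !partialE//.
  exact/near_eq_cderive/near_eq_chart.
- move=> a f g sf sg; have [D [Dx cf cg]] := key f g sf sg.
  have ca : csmooth_rn [set cmap c x] (fun=> a) by exact: csmooth_rn_cst.
  have {}cf : csmooth_rn [set cmap c x] (fun u => f (cinv c u)).
    exact: (csmooth_rn_pointwise D _).1 cf _ Dx.
  have {}cg : csmooth_rn [set cmap c x] (fun u => g (cinv c u)).
    exact: (csmooth_rn_pointwise D _).1 cg _ Dx.
  have saf : smooth_at x (fun z => a * f z).
    by apply: smooth_atM => //; exact: smooth_at_cst.
  rewrite partialE; last exact: smooth_atD.
  have [E [Ex caf _]] := key _ _ saf sg.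
  have {}caf : csmooth_rn [set cmap c x] (fun u => a * f (cinv c u)).
    exact: (csmooth_rn_pointwise E _).1 caf _ Ex.
  rewrite (cderiveD _ caf cg)// (cderiveM _ ca cf)// cderive_cst mulr0 addr0.
  by rewrite !partialE.
- move=> f g sf sg; have [D [Dx cf cg]] := key f g sf sg.
  rewrite !partialE//; last exact: smooth_atM.
  by rewrite (cderiveM _ cf cg Dx) cmapK.
Qed.

Lemma partial_smooth c j V f : atlas c -> open V -> smooth V f ->
  csmooth_rn (chart_image c V) (fun u => partial c j (cinv c u) f).
Proof.
move=> ac oV sf; have := csmooth_rn_cderive j ((smoothE V f).1 sf c ac).
apply: csmooth_rn_eq => [|u /chart_imageK[_ Vu uE]]; first exact: open_chart_image.
by rewrite partialE ?uE//; exists V.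
Qed.

Lemma partial_coord c j k x : atlas c -> cdom c x ->
  partial c j x (chart_coord c k) = (j == k)%:R.
Proof.
move=> ac cx; rewrite partialE; last first.
  by exists (cdom c); split=> //; [exact: cdom_open|exact: smooth_chart_coord].
have e : \forall u \near cmap c x, chart_coord c k (cinv c u) = (u 0 k)%:C.
  have := open_nbhs_nbhs (conj (open_chart_image openT) (chart_image_in cx I)).
  by apply: filterS => u /chart_imageK[_ _ uE]; rewrite /chart_coord uE.
rewrite (near_eq_cderive _ e) /cderive /= derive_cst.
suff -> : 'D_(delta_mx 0 j) (fun u : 'rV[R]_n => u 0 k) (cmap c x) = (j == k)%:R.
  by case: (j == k).
rewrite /derive; apply/lim_near_cst => //; near=> h => /=.
rewrite !mxE addrK eqxx /= /GRing.scale/= eq_sym mulrA mulVf ?mul1r//.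
by near: h; exact: nbhs_dnbhs_neq.
Unshelve. all: by end_near. Qed.

End SmoothFunctions.

(** * Partitions of unity *)

Section Partition.
Variables (R : realType) (n : nat) (M : smoothManifold R n).
Implicit Types (U V S W : set M) (f g : cfunc M) (x : M).

(** A quotient a/(a+b), where a vanishes exactly for |s| >= 1 and b exactly for |s| <= 1/2, so the
    denominator is positive everywhere. Squares replace |s| to keep the formula smooth at 0. *)
Definition bump (s : R) : R :=
  flat 0 (1 - s * s) * (flat 0 (1 - s * s) + flat 0 (s * s - 4^-1))^-1.

Lemma flat0_ge0 (s : R) : 0 <= flat 0 s.
Proof. by rewrite /flat; case: ifP => // _; rewrite expr0 mul1r expR_ge0. Qed.

Lemma flat0_gt0 (s : R) : 0 < s -> 0 < flat 0 s.
Proof. by move=> s0; rewrite /flat s0 expr0 mul1r expR_gt0. Qed.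

Lemma flat0_eq0 (s : R) : s <= 0 -> flat 0 s = 0.
Proof. by move=> s0; rewrite /flat ltNge s0. Qed.

Lemma bump_denom_neq0 (s : R) :
  flat 0 (1 - s * s) + flat 0 (s * s - 4^-1) != 0.
Proof.
rewrite gt_eqF//; have [s1|s1] := ltP (s * s) 1.
  by rewrite ltr_wpDr ?flat0_ge0// flat0_gt0// subr_gt0.
rewrite ltr_wpDl ?flat0_ge0// flat0_gt0// subr_gt0.
by apply: lt_le_trans s1; rewrite invf_lt1// ltr1n.
Qed.

Lemma sqr_normE (s : R) : s * s = `|s| * `|s|.
Proof. by rewrite -normrM ger0_norm// -expr2 sqr_ge0. Qed.

Lemma bump_eq1 (s : R) : `|s| < 2^-1 -> bump s = 1.
Proof.
move=> s2; have H : s * s <= 4^-1.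
  have -> : (4^-1 : R) = 2^-1 * 2^-1 by rewrite -invfM -natrM.
  by rewrite sqr_normE ler_pM// ltW.
rewrite /bump; have := bump_denom_neq0 s.
by rewrite (flat0_eq0 (s := s * s - _)) ?subr_le0// addr0 => h; rewrite mulfV.
Qed.

Lemma bump_eq0 (s : R) : 1 < `|s| -> bump s = 0.
Proof.
move=> s1; rewrite /bump flat0_eq0 ?mul0r// subr_le0.
by rewrite sqr_normE -expr2 exprn_ege1// ltW.
Qed.

Lemma smooth_rn_bump (D : set 'rV[R]_n) F : open D -> smooth_rn D F ->
  smooth_rn D (fun u => bump (F u)).
Proof.
move=> oD sF.
have sF2 : smooth_rn D (fun u => F u * F u) by exact: smooth_rnM.
have s1 : smooth_rn D (fun u => flat 0 (1 - F u * F u)).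
  apply: smooth_rn_flat => //; rewrite (_ : (fun u => _) = fun u => 1 + (-1) * (F u * F u)).
    apply: smooth_rnD => //; first exact: smooth_rn_cst.
    by apply: smooth_rnM => //; exact: smooth_rn_cst.
  by apply/funext => u; rewrite mulN1r.
have s2 : smooth_rn D (fun u => flat 0 (F u * F u - 4^-1)).
  by apply: smooth_rn_flat => //; apply: smooth_rnD => //; exact: smooth_rn_cst.
apply: smooth_rnM => //; apply: smooth_rnV => //; first exact: smooth_rnD.
by move=> u _; exact: bump_denom_neq0.
Qed.

Lemma bump_function U x : open U -> U x ->
  exists (f : cfunc M) (W S : set M),
    [/\ smooth setT f, open W /\ W x, closed S /\ S `<=` U,
        forall z, W z -> f z = 1 & forall z, ~ S z -> f z = 0].
Proof.
move=> oU Ux; have [c ac cx] := atlas_cover x.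
set a := cmap c x.
have : nbhs a (chart_image c U).
  by apply: open_nbhs_nbhs; split; [exact: open_chart_image|exact: chart_image_in].
rewrite -nbhs_ballE => -[e /= e0 eU].
(* Halving [e] keeps the closed box [K] of radius [r] inside the open ball, hence inside the image
   of [U]. *)
pose r := e / 2; have r0 : 0 < r by rewrite divr_gt0.
pose K := [set u : 'rV[R]_n | forall j, `[a 0 j - r, a 0 j + r]%classic (u 0 j)].
have cK : compact K.
  apply: (@rV_compact _ _ (fun j => `[a 0 j - r, a 0 j + r]%classic)) => j.
  exact: segment_compact.
have KU : K `<=` chart_image c U.
  move=> u Ku; apply: eU; split=> // i j; rewrite ord1 /ball/=.
  have := Ku j; rewrite /= in_itv/= => /andP[h1 h2].
  apply: (@le_lt_trans _ _ r); last by rewrite /r ltr_pdivrMr// ltr_pMr// ltr1n.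
  by rewrite ler_norml; apply/andP; split; lra.
pose S := cinv c @` K.
have SU : S `<=` U by move=> z [u /KU/chart_imageK[_ Uu _] <-].
(* [S] is compact in a Hausdorff space, hence closed. Its complement is then an open set on which
   [f] is 0, so the extension by zero beyond the chart is smooth. *)
have clS : closed S.
  apply: compact_closed; first exact: manifold_hausdorff.
  apply: continuous_compact => //.
  apply: continuous_subspaceW (@cinv_continuous _ _ _ c) => u /KU[z [cz _] <-].
  by exists z.
pose b j z := (bump ((cmap c z 0 j - a 0 j) * r^-1))%:C.
pose f z := if `[< cdom c z >] then \prod_j b j z else 0.
(* Within radius [r / 2] every argument of [bump] is below 1/2 in absolute value, so [f] is 1 on
   [W]. *)
pose W := cdom c `&` cmap c @^-1` (ball a (r / 2))°.
have oW : open W.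
  have oc : open (cdom c) by exact: cdom_open.
  apply: (iffLR (continuous_inP (cmap c) oc)); last exact: open_interior.
  by rewrite -continuous_open_subspace//; exact: cmap_continuous.
have f0 z : ~ S z -> f z = 0.
  move=> nSz; rewrite /f; case: asboolP => // cz.
  have : ~ K (cmap c z) by move=> Kz; apply: nSz; exists (cmap c z) => //; exact: cmapK.
  move=> /existsNP[j]; rewrite /= in_itv/= => h.
  rewrite (bigD1 j)//= /b bump_eq0 ?mul0r//.
  rewrite normrM (gtr0_norm (x := r^-1)) ?invr_gt0// ltr_pdivlMr// mul1r ltNge.
  apply/negP; rewrite ler_norml => /andP[h1 h2]; apply: h; apply/andP; split; lra.
exists f, W, S; split=> //.
- apply: smooth_local => z _; have [cz|ncz] := pselect (cdom c z).
    exists (cdom c) => //.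
    have oc : open (cdom c) by exact: cdom_open.
    apply: (smooth_eq oc (f := fun z => \prod_j b j z)).
      by move=> y cy; rewrite /f asboolT.
    apply: smooth_prod => // j; apply/smoothE => d ad; split; last exact: smooth_rn_cst.
    rewrite /=; apply: smooth_rn_bump; first exact: open_chart_image.
    apply: smooth_rnM; [exact: open_chart_image| |exact: smooth_rn_cst].
    apply: smooth_rnD; [exact: open_chart_image| |exact: smooth_rn_cst].
    exact: atlas_compat.
  have oS : open (~` S) by exact: closed_openC.
  exists (~` S); first by move=> [u /KU/chart_imageK[cz _ _] uz]; apply: ncz; rewrite -uz.
  apply: (smooth_eq oS (f := fun=> 0)); last exact: smooth_cst.
  by move=> y /f0.
- split=> //; split=> //=; apply: nbhsx_ballx; exact: divr_gt0.
- move=> z [cz /interior_subset zb]; rewrite /f asboolT// big1// => j _.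
  rewrite /b bump_eq1//; have [_ /(_ ord0 j)] := zb; rewrite /ball/= distrC => zbj.
  by rewrite normrM (gtr0_norm (x := r^-1)) ?invr_gt0// ltr_pdivrMr// mulrC.
Qed.

(* [p k = f k * \prod_(j < k) (1 - f j)] vanishes on the set [W j] where
   [f j = 1] as soon as [j < k]: a countable cover needs no locally finite
   refinement. *)
Lemma partition_of_unity (G : set (set M)) : G set0 ->
  (forall x, exists U, [/\ G U, open U & U x]) ->
  exists (U S W : nat -> set M) (p : nat -> cfunc M),
  [/\ forall k, [/\ G (U k), closed (S k) & S k `<=` U k],
      forall k, smooth setT (p k) /\ (forall z, ~ S k z -> p k z = 0),
      (forall k, open (W k)) /\ (forall z, exists k, W k z),
      forall j k z, W j z -> (j < k)%N -> p k z = 0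
    & forall j z, W j z -> \sum_(k < j.+1) p k z = 1].
Proof.
move=> G0 cov.
pose good (d : set M * set M * set M * cfunc M) :=
  let: (U, Z, W, f) := d in
  [/\ G U, closed Z /\ Z `<=` U, open W, smooth setT f &
    (forall z, W z -> f z = 1) /\ (forall z, ~ Z z -> f z = 0)].
have /choice[D goodD] : forall x, exists d, good d /\ d.1.2 x.
  move=> x; have [U [GU oU Ux]] := cov x.
  have [f [W [S [sf [oW Wx] [cS SU] f1 f0]]]] := bump_function oU Ux.
  by exists (U, S, W, f).
have [B cB [Bo Bn]] := @manifold_countable _ _ M.
have /countable_injP[h hinj] := cB.
(* One datum is kept for each basis set contained in the third component of some [D x], indexed by
   its code under the injection [h]; this makes the cover countable. *)
have /choice[E goodE] : forall k, exists d, good d /\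
    forall b x, B b -> h b = k -> b `<=` (D x).1.2 -> b `<=` d.1.2.
  move=> k; have [[b [x [Bb hb bx]]]|nex] :=
      pselect (exists b x, [/\ B b, h b = k & b `<=` (D x).1.2]).
    exists (D x); split; first by have [] := goodD x.
    move=> b' x' Bb' hb' _; rewrite (hinj b' b) ?inE//.
    by rewrite hb hb'.
  (* Codes that come from no such basis set receive the empty datum, which is admissible by
     [G set0]. *)
  exists (set0, set0, set0, fun=> 0); split.
    split=> //; [by split; [exact: closed0|]|exact: open0|exact: smooth_cst].
  by move=> b x Bb hb bx; exfalso; apply: nex; exists b, x.
pose U k := (E k).1.1.1; pose S k := (E k).1.1.2; pose W k := (E k).1.2.
pose f k := (E k).2.
have HE k : [/\ G (U k), closed (S k) /\ S k `<=` U k, open (W k),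
    smooth setT (f k) &
    (forall z, W k z -> f k z = 1) /\ (forall z, ~ S k z -> f k z = 0)].
  by rewrite /U /S /W /f; have [] := goodE k; case: (E k) => [[[? ?] ?] ?].
have Wcov z : exists k, W k z.
  have [_ Wz] := goodD z.
  have oW : open (D z).1.2 by have [] := goodD z; case: (D z) => [[[? ?] ?] ?] [].
  have [b [Bb bz] bW] := Bn z _ (open_nbhs_nbhs (conj oW Wz)).
  exists (h b); have [_ H] := goodE (h b); exact: (H b z).
pose q k z := \prod_(j < k) (1 - f j z).
pose p k z := f k z * q k z.
(* The sum telescopes to one minus a product, and this product vanishes as soon as one factor
   [1 - f j] does. *)
have sump m z : \sum_(k < m) p k z = 1 - q m z.
  elim: m => [|m IH]; first by rewrite big_ord0 /q big_ord0 subrr.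
  by rewrite big_ord_recr IH /p /q /= big_ord_recr /=; ring.
have q0 j m z : W j z -> (j < m)%N -> q m z = 0.
  move=> Wz jm; have [_ _ _ _ [f1 _]] := HE j.
  by rewrite /q (bigD1 (Ordinal jm))//= f1// subrr mul0r.
exists U, S, W, p; split.
- by move=> k; have [? [? ?] _ _ _] := HE k.
- move=> k; have [_ _ _ sf [_ f0]] := HE k; split=> [|z /f0]; last first.
    by rewrite /p => ->; rewrite mul0r.
  apply: smoothM => //; [exact: openT|]; apply: smooth_prod => [|j]; first exact: openT.
  by apply: smoothB; [exact: openT|exact: smooth_cst|have [] := HE j].
- by split=> // k; have [] := HE k.
- by move=> j k z Wz jk; rewrite /p (q0 _ _ _ Wz jk) mulr0.
- by move=> j z Wz; rewrite sump (q0 _ _ _ Wz)// subr0.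
Qed.

End Partition.

(** * Tangent vectors, vector fields and their brackets *)

Section TangentSpace.
Variables (R : realType) (n : nat) (M : smoothManifold R n).
Implicit Types (U V : set M) (f g : cfunc M) (x z : M) (u v : tvec M).

Definition tvscale (a : R[i]) v : tvec M := fun f => a * v f.

Lemma tvsumE (I : Type) (r : seq I) (P : pred I) (F : I -> tvec M) f :
  (\sum_(i <- r | P i) F i) f = \sum_(i <- r | P i) F i f.
Proof. by rewrite fct_sumE. Qed.

Lemma tangent0 x : tangent x (0 : tvec M).
Proof. by split=> // *; rewrite /= ?mulr0 ?addr0. Qed.

Lemma tangentD x u v : tangent x u -> tangent x v -> tangent x (u + v).
Proof.
move=> [u1 u2 u3 u4] [v1 v2 v3 v4]; split.
- by move=> f nf; change (u f + v f = 0); rewrite u1// v1// addr0.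
- by move=> f g sf sg fg; change (u f + v f = u g + v g); rewrite (u2 f g)// (v2 f g).
- move=> a f g sf sg.
  change (u (fun z => a * f z + g z) + v (fun z => a * f z + g z) =
    a * (u f + v f) + (u g + v g)).
  by rewrite u3// v3//; ring.
- move=> f g sf sg.
  change (u (fun z => f z * g z) + v (fun z => f z * g z) =
    f x * (u g + v g) + g x * (u f + v f)).
  by rewrite u4// v4//; ring.
Qed.

Lemma tangentZ x a v : tangent x v -> tangent x (tvscale a v).
Proof.
move=> [v1 v2 v3 v4]; rewrite /tvscale; split.
- by move=> f nf; rewrite v1// mulr0.
- by move=> f g sf sg fg; rewrite (v2 f g).
- by move=> b f g sf sg; rewrite v3//; ring.
- by move=> f g sf sg; rewrite v4//; ring.
Qed.

Lemma tangentN x v : tangent x v -> tangent x (- v).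
Proof.
move=> /(@tangentZ _ (-1)).
by rewrite (_ : tvscale _ _ = - v)//; apply/funext => f; rewrite /tvscale mulN1r.
Qed.

Lemma tangent_sum x (I : Type) (r : seq I) (P : pred I) (F : I -> tvec M) :
  (forall i, P i -> tangent x (F i)) -> tangent x (\sum_(i <- r | P i) F i).
Proof.
by move=> tF; apply: big_ind => //; [exact: tangent0|move=> *; exact: tangentD].
Qed.

Section Derivation.
Variables (x : M) (v : tvec M) (tv : tangent x v).

Lemma tangent_vec0 : v (fun=> 0) = 0.
Proof.
have := tangent_linear tv 1 (smooth_at_cst x 0) (smooth_at_cst x 0).
rewrite (_ : (fun z => 1 * 0 + 0) = fun=> 0); last first.
  by apply/funext => ?; rewrite mulr0 addr0.
by rewrite mul1r -[LHS]addr0 => /addrI/esym.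
Qed.

Lemma tangent_add f g : smooth_at x f -> smooth_at x g ->
  v (fun z => f z + g z) = v f + v g.
Proof.
move=> sf sg; rewrite -[v f]mul1r -(tangent_linear tv)//.
by congr v; apply/funext => z; rewrite mul1r.
Qed.

Lemma tangent_vsum (I : Type) (r : seq I) (F : I -> cfunc M) :
  (forall i, smooth_at x (F i)) ->
  v (fun z => \sum_(i <- r) F i z) = \sum_(i <- r) v (F i).
Proof.
move=> sF.
suff [] : v (fun z => \sum_(i <- r) F i z) = \sum_(i <- r) v (F i) /\
    smooth_at x (fun z => \sum_(i <- r) F i z) by [].
elim: r => [|i r [IH sr]].
  rewrite big_nil (_ : (fun z => _) = fun=> 0).
    by split; [exact: tangent_vec0|exact: smooth_at_cst].
  by apply/funext => z; rewrite big_nil.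
rewrite big_cons (_ : (fun z => _) = fun z => F i z + \sum_(j <- r) F j z).
  by rewrite tangent_add// IH; split=> //; exact: smooth_atD.
by apply/funext => z; rewrite big_cons.
Qed.

Lemma tangent_eq_on U f g : open U -> U x -> smooth U f ->
  (forall z, U z -> f z = g z) -> v f = v g.
Proof.
move=> oU Ux sf fg; apply: (tangent_germ tv).
- by exists U.
- by exists U; split=> //; exact: smooth_eq sf.
- by apply: filterS (open_nbhs_nbhs (conj oU Ux)) => z /fg.
Qed.

End Derivation.

Lemma is_field_sub U V (X : vfield M) : V `<=` U -> is_field U X -> is_field V X.
Proof.
move=> VU [tX sX]; split=> [x /VU|V' f oV' V'V]; first exact: tX.
by apply: sX => // x /V'V/VU.
Qed.

Lemma is_field_local U (X : vfield M) :
  (forall x, U x -> exists V, [/\ open V, V x & is_field V X]) -> is_field U X.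
Proof.
move=> H; split=> [x Ux|V f oV VU sf]; first by have [V [_ Vx [tX _]]] := H x Ux; exact: tX.
apply: smooth_local => x Vx; have [V' [oV' V'x [_ sX]]] := H x (VU x Vx).
exists (V `&` V') => //; apply: sX; first exact: openI.
- by move=> z [].
- by apply: smooth_sub sf => z [].
Qed.

Lemma is_field_eq U (X Y : vfield M) : (forall x, U x -> X x = Y x) ->
  is_field U X -> is_field U Y.
Proof.
move=> XY [tX sX]; split=> [x Ux|V f oV VU sf]; first by rewrite -XY//; exact: tX.
by apply: smooth_eq (sX V f oV VU sf) => // x /VU Ux; rewrite /fapp XY.
Qed.

Lemma is_fieldD U (X Y : vfield M) : is_field U X -> is_field U Y -> is_field U (X + Y).
Proof.
move=> [tX sX] [tY sY]; split=> [x Ux|V f oV VU sf].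
  by apply: tangentD; [exact: tX|exact: tY].
by apply: (smoothD oV (sX V f oV VU sf) (sY V f oV VU sf)).
Qed.

Lemma is_field0 U : is_field U (0 : vfield M).
Proof. by split=> [x Ux|V f oV VU sf]; [exact: tangent0|exact: smooth_cst]. Qed.

Lemma is_field_scale U f (X : vfield M) : smooth U f -> is_field U X ->
  is_field U (fscale f X).
Proof.
move=> sf [tX sX]; split=> [x Ux|V g oV VU sg]; first exact/tangentZ/tX.
by apply: smoothM => //; [exact: smooth_sub sf|exact: sX].
Qed.

Lemma is_field_sum U (I : Type) (r : seq I) (P : pred I) (F : I -> vfield M) :
  (forall i, P i -> is_field U (F i)) -> is_field U (\sum_(i <- r | P i) F i).
Proof.
by move=> sF; apply: big_ind => //; [exact: is_field0|exact: is_fieldD].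
Qed.

Lemma bracketE (X Y : vfield M) x f : smooth_at x f ->
  bracket X Y x f = X x (fapp Y f) - Y x (fapp X f).
Proof. by move=> sf; rewrite /bracket asboolT. Qed.

Lemma is_field_bracket U (X Y : vfield M) : open U -> is_field U X -> is_field U Y ->
  is_field U (bracket X Y).
Proof.
move=> oU [tX sX] [tY sY].
have key x f : U x -> smooth_at x f -> exists V, [/\ open V, V x, V `<=` U & smooth V f].
  move=> Ux [V [oV Vx sf]]; exists (V `&` U).
  by split; [exact: openI|by []|by move=> z []|apply: smooth_sub sf => z []].
have key2 x f : U x -> smooth_at x f -> smooth_at x (fapp X f) /\ smooth_at x (fapp Y f).
  move=> Ux /(key x f Ux)[V [oV Vx VU sf]].
  by split; exists V; split=> //; [exact: sX|exact: sY].
split=> [x Ux|V f oV VU sf].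
  have [tXx tYx] := (tX x Ux, tY x Ux).
  have loc f g h k : smooth_at x f -> smooth_at x g -> smooth_at x h ->
      smooth_at x k ->
      exists V, [/\ open V /\ V x, V `<=` U, smooth V f /\ smooth V g &
        smooth V h /\ smooth V k].
    move=> sf sg sh sk.
    have [V1 [oV1 V1x sf1 sg1]] := smooth_at2 sf sg.
    have [V2 [oV2 V2x sh2 sk2]] := smooth_at2 sh sk.
    exists (V1 `&` V2 `&` U); split.
    - by split=> //; apply: openI => //; exact: openI.
    - by move=> z [].
    - by split; [apply: smooth_sub sf1|apply: smooth_sub sg1] => z [[]].
    - by split; [apply: smooth_sub sh2|apply: smooth_sub sk2] => z [[]].
  split.
  - by move=> f nf; rewrite /bracket asboolF.
  - move=> f g sf sg fg; rewrite !bracketE//.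
    have [V [[oV Vx] VU [sf' sg'] _]] := loc _ _ _ _ sf sg sf sg.
    have [V2 [oV2 V2x fg2]] := near_open fg.
    have oW : open (V `&` V2) by exact: openI.
    have WU : V `&` V2 `<=` U by move=> z [/VU].
    have sW h : smooth V h -> smooth (V `&` V2) h by apply: smooth_sub => z [].
    congr (_ - _).
      apply: (tangent_eq_on tXx oW) => //; first by apply: sY => //; exact: sW.
      move=> z [Vz V2z]; apply: (tangent_eq_on (tY z (VU z Vz)) oW) => //; first exact: sW.
      by move=> y [_ /fg2].
    apply: (tangent_eq_on tYx oW) => //; first by apply: sX => //; exact: sW.
    move=> z [Vz V2z]; apply: (tangent_eq_on (tX z (VU z Vz)) oW) => //; first exact: sW.
    by move=> y [_ /fg2].
  - move=> a f g sf sg.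
    have [V [[oV Vx] VU [sf' sg'] _]] := loc _ _ _ _ sf sg sf sg.
    have safg : smooth V (fun z => a * f z + g z).
      by apply: smoothD => //; exact: smooth_scale.
    rewrite !bracketE//; last by exists V.
    (* The outer derivation sees only germs, so the inner expression may be expanded on the
       neighbourhood [V] of [x] before the outer one is applied. *)
    have E (Z : vfield M) : (forall x, U x -> tangent x (Z x)) ->
        forall z, V z -> a * fapp Z f z + fapp Z g z = fapp Z (fun z => a * f z + g z) z.
      by move=> tZ z Vz; rewrite /fapp (tangent_linear (tZ z (VU z Vz)))//; exists V.
    rewrite -(tangent_eq_on tXx oV Vx _ (E Y tY)); last first.
      by apply: smoothD => //; [apply: smooth_scale => //|]; exact: sY.
    rewrite -(tangent_eq_on tYx oV Vx _ (E X tX)); last first.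
      by apply: smoothD => //; [apply: smooth_scale => //|]; exact: sX.
    have [[sXf sYf] [sXg sYg]] := (key2 x f Ux sf, key2 x g Ux sg).
    by rewrite (tangent_linear tXx)// (tangent_linear tYx)//; ring.
  - move=> f g sf sg.
    have [V [[oV Vx] VU [sf' sg'] _]] := loc _ _ _ _ sf sg sf sg.
    have sfg : smooth V (fun z => f z * g z) by exact: smoothM.
    rewrite !bracketE//; last by exists V.
    have E (Z : vfield M) : (forall x, U x -> tangent x (Z x)) ->
        forall z, V z -> f z * fapp Z g z + g z * fapp Z f z = fapp Z (fun z => f z * g z) z.
      by move=> tZ z Vz; rewrite /fapp (tangent_leibniz (tZ z (VU z Vz)))//; exists V.
    have [[sXf sYf] [sXg sYg]] := (key2 x f Ux sf, key2 x g Ux sg).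
    rewrite -(tangent_eq_on tXx oV Vx _ (E Y tY)); last first.
      by apply: smoothD => //; apply: smoothM => //; exact: sY.
    rewrite -(tangent_eq_on tYx oV Vx _ (E X tX)); last first.
      by apply: smoothD => //; apply: smoothM => //; exact: sX.
    rewrite (tangent_add tXx); [|exact: smooth_atM|exact: smooth_atM].
    rewrite (tangent_add tYx); [|exact: smooth_atM|exact: smooth_atM].
    (* The mixed products of [X f] with [Y g] and of [X g] with [Y f] occur in both compositions and
       cancel in the difference. *)
    rewrite !(tangent_leibniz tXx)// !(tangent_leibniz tYx)// /fapp; ring.
apply: (smooth_eq oV (f := fun x => fapp X (fapp Y f) x - fapp Y (fapp X f) x)).
  by move=> x Vx; rewrite /fapp bracketE//; exists V.
by apply: smoothB => //; [apply: sX => //; exact: sY|apply: sY => //; exact: sX].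
Qed.

End TangentSpace.

(** * Coordinate frames *)

Section Frames.
Variables (R : realType) (n : nat) (M : smoothManifold R n).
Implicit Types (U V : set M) (f g : cfunc M) (x z : M) (u v : tvec M).

Definition coordinates U (q : nat) (zeta : 'I_q -> cfunc M) :=
  [/\ open U, forall i, smooth U (zeta i) &
      forall z, U z -> forall v, tangent z v -> (forall i, v (zeta i) = 0) -> v = 0].

(* The chart fields are independent, and by [coordinates] they embed in
   [R[i] ^ q]; hence [q <= n] makes the Jacobian matrix invertible. *)
Lemma coordinate_frame U q (zeta : 'I_q -> cfunc M) : (q <= n)%N ->
  coordinates U zeta ->
  exists e : 'I_q -> vfield M,
    [/\ forall i z, tangent z (e i z),
        forall z, U z -> forall i j, e i z (zeta j) = (i == j)%:R,
        forall i, is_field U (e i)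
      & forall i z, ~ U z -> e i z = 0].
Proof.
move=> qn [oU sz injz].
(* Comparing dimensions takes a point of [U]; over the empty set [q] may be smaller than [n], and
   the zero fields are a solution. *)
have [/eqP U0|/set0P[z0 Uz0]] := boolP (U == set0).
  exists (fun=> 0); split=> //; rewrite ?U0 // => i; last exact: is_field0.
  exact: tangent0.
pose J c z := \matrix_(j < n, i < q) partial c j z (zeta i).
have sat z i : U z -> smooth_at z (zeta i) by move=> Uz; exists U.
have Jfree c z : atlas c -> cdom c z -> U z -> row_free (J c z).
  move=> ac cz Uz; apply: inj_row_free => a aJ0; apply/rowP => k; rewrite mxE.
  pose v : tvec M := \sum_j tvscale (a 0 j) (partial c j z).
  have tv : tangent z v.
    by apply: tangent_sum => j _; apply: tangentZ; exact: tangent_partial.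
  have v0 : v = 0.
    apply: (injz z Uz v tv) => i; rewrite /v tvsumE.
    have := congr1 (fun A : 'rV_q => A 0 i) aJ0; rewrite !mxE => aJ; rewrite -[RHS]aJ.
    by apply: eq_bigr => j _; rewrite mxE.
  (* Applying the combination to the chart coordinate [k] reads off the coefficient [a 0 k]. *)
  move/(congr1 (fun v => v (chart_coord c k))) : v0.
  rewrite /v tvsumE (bigD1 k)//= big1 => [|j jk].
    by rewrite /tvscale partial_coord// eqxx mulr1 addr0.
  by rewrite /tvscale partial_coord// (negbTE jk) mulr0.
have [c0 ac0 c0z0] := atlas_cover z0.
have qE : q = n.
  apply/eqP; rewrite eqn_leq qn /=.
  have := Jfree c0 z0 ac0 c0z0 Uz0; rewrite /row_free => /eqP <-.
  exact: rank_leq_col.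
subst q.
have Junit c z : atlas c -> cdom c z -> U z -> J c z \in unitmx.
  by move=> ac cz Uz; rewrite -row_free_unit; exact: Jfree.
pose E c i z : tvec M := \sum_j tvscale (invmx (J c z) i j) (partial c j z).
have tE c i z : atlas c -> cdom c z -> tangent z (E c i z).
  by move=> ac cz; apply: tangent_sum => j _; apply: tangentZ; exact: tangent_partial.
have EE c i z k : atlas c -> cdom c z -> U z -> E c i z (zeta k) = (i == k)%:R.
  move=> ac cz Uz; have := mulVmx (Junit c z ac cz Uz).
  move=> /matrixP/(_ i k); rewrite !mxE => <-; rewrite /E tvsumE.
  by apply: eq_bigr => j _; rewrite [in RHS]mxE.
have /choice[ch chP] : forall z, exists c, atlas c /\ cdom c z.
  by move=> z; have [c ac cz] := atlas_cover z; exists c.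
pose e i z : tvec M := if `[< U z >] then E (ch z) i z else 0.
(* [ch] picks charts without any continuity. A tangent vector is determined by its values on the
   [zeta k], so every chart yields the same [e], and smoothness can be checked in a fixed one. *)
have eE c i z : atlas c -> cdom c z -> U z -> e i z = E c i z.
  move=> ac cz Uz; rewrite /e asboolT//; have [ac' cz'] := chP z.
  apply/eqP; rewrite -subr_eq0; apply/eqP; apply: (injz z Uz).
    by apply: tangentD; [exact: tE|apply: tangentN; exact: tE].
  move=> k; change (E (ch z) i z (zeta k) - E c i z (zeta k) = 0).
  by rewrite !EE// subrr.
have te i z : tangent z (e i z).
  rewrite /e; case: asboolP => _; last exact: tangent0.
  by have [ac cz] := chP z; exact: tE.
exists e; split=> //.
- by move=> z Uz i j; have [ac cz] := chP z; rewrite (eE _ _ _ ac cz)// EE.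
- move=> i; split=> // V f oV VU sf; apply/smoothE => c ac.
  have oI : open (chart_image c V) by exact: open_chart_image.
  apply: (@csmooth_rn_eq _ _ _ (fun p => \sum_j invmx (J c (cinv c p)) i j *
      partial c j (cinv c p) f) _ oI).
    move=> u /chart_imageK[cu Vu _]; rewrite /fapp (eE c)//; last exact: VU.
    by rewrite /E tvsumE.
  apply: csmooth_rn_sum => // j _; apply: csmooth_rnM => //; last exact: partial_smooth.
  apply: csmooth_rn_invmx => // [k l|u /chart_imageK[cu Vu _]]; last first.
    by apply: Junit => //; exact: VU.
  under eq_fun do rewrite mxE.
  by apply: partial_smooth => //; apply: smooth_sub (sz l).
- by move=> i z nUz; rewrite /e asboolF.
Qed.

End Frames.

(** * Cauchy products and recursion on coefficients *)

Section CauchySums.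
Variable V : nmodType.
Implicit Types F G : nat -> nat -> V.

(** The family is indexed by pairs and not built from two sequences, so that nested products of
    different operations can be reordered by acting on indices alone. *)
Definition conv F (k : nat) : V := \sum_(i < k.+1) F i (k - i)%N.

Lemma conv0 F : conv F 0 = F 0%N 0%N.
Proof. by rewrite /conv big_ord_recl big_ord0 addr0. Qed.

Lemma eq_conv F G : (forall i j, F i j = G i j) -> conv F =1 conv G.
Proof. by move=> FG k; apply: eq_bigr. Qed.

Lemma convC F : conv F =1 conv (fun i j => F j i).
Proof.
move=> k; rewrite /conv (reindex_inj rev_ord_inj)/=; apply: eq_bigr => i _.
by rewrite subSS subKn// -ltnS.
Qed.

Lemma convD F G k : conv (fun i j => F i j + G i j) k = conv F k + conv G k.
Proof. by rewrite /conv big_split. Qed.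

Lemma conv_eq0 F k : (forall i j, F i j = 0) -> conv F k = 0.
Proof. by move=> F0; rewrite /conv big1. Qed.

Lemma conv_big (I : Type) (r : seq I) (F : I -> nat -> nat -> V) k :
  conv (fun i j => \sum_(a <- r) F a i j) k = \sum_(a <- r) conv (F a) k.
Proof. exact: exchange_big. Qed.

(** Both sides run over the triples of indices with total [k]. *)
Lemma convA (F : nat -> nat -> nat -> V) :
  conv (fun i l => conv (fun j m => F i j m) l) =1
  conv (fun l m => conv (fun i j => F i j m) l).
Proof.
move=> k; rewrite /conv; pose G i l := F i (l - i)%N (k - l)%N.
transitivity (\sum_(l < k.+1) \sum_(i < k.+1 | (i <= l)%N) G i l); last first.
  apply: eq_bigr => l _.
  by rewrite (big_ord_widen k.+1 (fun i => F i (l - i)%N (k - l)%N) (ltn_ord l)).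
rewrite (exchange_big_dep xpredT)//=; apply: eq_bigr => i _.
rewrite -(big_geq_mkord i k.+1 xpredT (G i)) -[X in index_iota X]add0n big_addn big_mkord.
rewrite subSn; last by rewrite -ltnS.
by apply: eq_bigr => j _; rewrite /G addnK addnC subnDA.
Qed.

End CauchySums.

Lemma conv_mulr (A : pzSemiRingType) (F : nat -> nat -> A) a k :
  a * conv F k = conv (fun i j => a * F i j) k.
Proof. exact: mulr_sumr. Qed.

(** Course-of-values recursion: [s k] lists the first [k] values, and [F k] cannot distinguish this
    list padded with [d] from the full sequence. *)
Lemma prefix_recursion (T : Type) (d : T) (F : nat -> (nat -> T) -> T) :
  (forall k X Y, (forall i, (i < k)%N -> X i = Y i) -> F k X = F k Y) ->
  exists X, forall k, X k = F k X.
Proof.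
move=> HF.
pose s := fix s k : seq T := if k is k'.+1 then rcons (s k') (F k' (nth d (s k'))) else [::].
have szs k : size (s k) = k by elim: k => //= k IH; rewrite size_rcons IH.
pose X k := nth d (s k.+1) k.
have sX k i : (i < k)%N -> nth d (s k) i = X i.
  elim: k => // k IH; rewrite ltnS leq_eqVlt => /orP[/eqP -> //|ik].
  by rewrite /= nth_rcons szs ik IH.
exists X => k; rewrite /X /= nth_rcons szs ltnn eqxx; apply: HF => i.
exact: sX.
Qed.

(** * Formal vector fields *)

Section FormalCalculus.
Variables (R : realType) (n : nat) (M : smoothManifold R n).
Implicit Types (U V : set M) (f g : tfunc M) (X Y Z : tfield M) (x z : M).

Lemma convAC (A : nmodType) (F : nat -> nat -> nat -> A) :
  conv (fun i l => conv (fun a b => F i a b) l) =1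
  conv (fun a l => conv (fun i b => F i a b) l).
Proof.
move=> k; rewrite convA (eq_conv (G := fun l b => conv (fun a i => F i a b) l)).
  by rewrite -convA.
by move=> l b; exact: convC.
Qed.

Definition tmul f g : tfunc M := fun k z => conv (fun i j => f i z * g j z) k.

Definition tap (v : nat -> tvec M) f (k : nat) := conv (fun i j => v i (f j)) k.

Lemma tappE X f k z : tapp X f k z = tap (fun i => X i z) f k.
Proof. by rewrite /tapp /Defs.cauchy fct_sumE. Qed.

Lemma tscaleE f X k z h : tscale f X k z h = conv (fun i j => f i z * X j z h) k.
Proof. by rewrite /tscale /Defs.cauchy !fct_sumE. Qed.

Lemma tbracketE X Y k z h :
  tbracket X Y k z h = conv (fun i j => bracket (X i) (Y j) z h) k.
Proof. by rewrite /tbracket /Defs.cauchy !fct_sumE. Qed.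

Lemma tpairE (w : tform M) X Y k z : tpair w X Y k z =
  conv (fun l c => conv (fun a b => w a z (X b z) (Y c z)) l) k.
Proof.
rewrite /tpair /Defs.cauchy fct_sumE; apply: eq_bigr => i _ /=.
by rewrite !fct_sumE.
Qed.

Lemma tdwedgeE f g k z v v' : tdwedge f g k z v v' =
  conv (fun a b => v (f a) * v' (g b) - v' (f a) * v (g b)) k.
Proof. by rewrite /tdwedge /Defs.cauchy !fct_sumE. Qed.

(** At order [k] the coefficient [v k] appears once, applied to [f 0]. This triangular shape gives
    both uniqueness and existence of formal fields with prescribed components. *)
Lemma tapE (v : nat -> tvec M) f k :
  tap v f k = \sum_(a < k) v a (f (k - a)%N) + v k (f 0%N).
Proof. by rewrite /tap /conv big_ord_recr /= subnn. Qed.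

Lemma smooth_conv U (F : nat -> nat -> cfunc M) k : open U ->
  (forall i j, smooth U (F i j)) -> smooth U (fun z => conv (fun i j => F i j z) k).
Proof. by move=> oU sF; apply: smooth_sum. Qed.

Lemma is_tfunc_tapp U X f : open U -> is_tfield U X -> is_tfunc U f ->
  is_tfunc U (tapp X f).
Proof.
move=> oU fX sf k; rewrite (_ : tapp X f k = fun z => conv (fun i j => fapp (X i) (f j) z) k).
  by apply: smooth_conv => // i j; have [_ sX] := fX i; apply: sX.
by apply/funext => z; rewrite tappE.
Qed.

Lemma is_tfunc_tmul U f g : open U -> is_tfunc U f -> is_tfunc U g ->
  is_tfunc U (tmul f g).
Proof. by move=> oU sf sg k; apply: smooth_conv => // i j; exact: smoothM. Qed.

Lemma is_tfunc_sub U V f : V `<=` U -> is_tfunc U f -> is_tfunc V f.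
Proof. by move=> VU sf k; apply: smooth_sub (sf k). Qed.

Lemma is_tfield_sub U V X : V `<=` U -> is_tfield U X -> is_tfield V X.
Proof. by move=> VU fX k; apply: is_field_sub (fX k). Qed.

Lemma is_tfield_scale U f X : is_tfunc U f -> is_tfield U X ->
  is_tfield U (tscale f X).
Proof. by move=> sf fX k; apply: is_field_sum => i _; exact: is_field_scale. Qed.

Lemma is_tfield_bracket U X Y : open U -> is_tfield U X -> is_tfield U Y ->
  is_tfield U (tbracket X Y).
Proof. by move=> oU fX fY k; apply: is_field_sum => i _; exact: is_field_bracket. Qed.

Lemma tangent_conv z v (F : nat -> nat -> cfunc M) k : tangent z v ->
  (forall i j, smooth_at z (F i j)) ->
  v (fun y => conv (fun i j => F i j y) k) = conv (fun i j => v (F i j)) k.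
Proof. by move=> tv sF; apply: (tangent_vsum tv) => i; exact: sF. Qed.

Lemma tappM U X f g k z : open U -> U z -> is_tfield U X -> is_tfunc U f ->
  is_tfunc U g ->
  tapp X (tmul f g) k z = tmul (tapp X f) g k z + tmul f (tapp X g) k z.
Proof.
move=> oU Uz fX sf sg; rewrite tappE /tap.
have tX i : tangent z (X i z) by have [tX _] := fX i; exact: tX.
have sfz i : smooth_at z (f i) by exists U.
have sgz i : smooth_at z (g i) by exists U.
transitivity (conv (fun i l => conv (fun a b => X i z (f a) * g b z) l) k +
    conv (fun i l => conv (fun a b => f a z * X i z (g b)) l) k).
  rewrite -convD; apply: eq_conv => i l; rewrite -convD.
    rewrite (tangent_conv (F := fun a b y => f a y * g b y) l (tX i)).
      by apply: eq_conv => a b; rewrite (tangent_leibniz (tX i))//; ring.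
    by move=> a b; exact: smooth_atM.
congr (_ + _).
  rewrite convA; apply: eq_conv => l b; rewrite tappE mulrC conv_mulr.
  by apply: eq_conv => i a; rewrite mulrC.
rewrite convAC; apply: eq_conv => a l; rewrite tappE conv_mulr.
exact: eq_conv.
Qed.

Lemma tapp_comp U X Y f k z : open U -> U z -> is_tfield U X -> is_tfield U Y ->
  is_tfunc U f ->
  tapp X (tapp Y f) k z =
  conv (fun a l => conv (fun b c => X a z (fapp (Y b) (f c))) l) k.
Proof.
move=> oU Uz fX fY sf; rewrite tappE /tap; apply: eq_conv => a l.
rewrite (_ : tapp Y f l = fun y => conv (fun b c => fapp (Y b) (f c) y) l).
  apply: tangent_conv => [|b c]; first by have [tX _] := fX a; exact: tX.
  by exists U; split=> //; have [_ sY] := fY b; apply: sY.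
by apply/funext => y; rewrite tappE.
Qed.

Lemma tapp_bracket U X Y f k z : open U -> U z -> is_tfield U X -> is_tfield U Y ->
  is_tfunc U f ->
  tapp (tbracket X Y) f k z = tapp X (tapp Y f) k z - tapp Y (tapp X f) k z.
Proof.
move=> oU Uz fX fY sf; rewrite !(@tapp_comp U)// tappE /tap.
apply/eqP; rewrite eq_sym subr_eq; apply/eqP.
(* Interchanging the orders of [X] and [Y] in one triple sum reduces the identity to the bracket
   formula for each pair of coefficients. *)
rewrite [X in _ = _ + X]convAC !convA -convD; apply: eq_conv => l c.
rewrite tbracketE -convD; apply: eq_conv => a b.
by rewrite bracketE ?subrK//; exists U.
Qed.

Lemma tapp_scale f X g k z : tapp (tscale f X) g k z = tmul f (tapp X g) k z.
Proof.
rewrite tappE /tap (eq_conv (G := fun l c => conv (fun i j => f i z * X j z (g c)) l)).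
  rewrite -convA; apply: eq_conv => a l; rewrite tappE conv_mulr.
  exact: eq_conv.
by move=> l c; rewrite tscaleE.
Qed.

Lemma tapp_addl X Y f k z : tapp (X + Y) f k z = tapp X f k z + tapp Y f k z.
Proof. by rewrite !tappE /tap -convD; apply: eq_conv. Qed.

Lemma tapp_addr U X f g k z : open U -> U z -> is_tfield U X -> is_tfunc U f ->
  is_tfunc U g ->
  tapp X (fun k y => f k y + g k y) k z = tapp X f k z + tapp X g k z.
Proof.
move=> oU Uz fX sf sg; rewrite !tappE /tap -convD; apply: eq_conv => i j.
have [tX _] := fX i; rewrite (tangent_add (tX z Uz))//; by exists U.
Qed.

Lemma tapp0 U X k z : U z -> is_tfield U X -> tapp X 0 k z = 0.
Proof.
move=> Uz fX; rewrite tappE /tap /conv big1// => i _.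
by have [tX _] := fX i; exact: tangent_vec0 (tX z Uz).
Qed.

Lemma tapp_eq U X Y f g k z : open U -> U z -> is_tfield U X -> is_tfunc U f ->
  (forall k y, U y -> f k y = g k y) -> (forall k, X k z = Y k z) ->
  tapp X f k z = tapp Y g k z.
Proof.
move=> oU Uz fX sf fg XY; rewrite !tappE /tap; apply: eq_conv => i j.
rewrite -XY; have [tX _] := fX i.
by apply: (tangent_eq_on (tX z Uz) oU) => // y; exact: fg.
Qed.

Section FormalFrame.
Variables (U : set M) (q : nat) (zeta : 'I_q -> tfunc M).
Hypotheses (qn : (q <= n)%N) (szeta : forall i, is_tfunc U (zeta i))
  (czeta : coordinates U (fun i => zeta i 0%N)).

Lemma formal_tangent_inj z (v v' : nat -> tvec M) : U z ->
  (forall k, tangent z (v k)) -> (forall k, tangent z (v' k)) ->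
  (forall i k, tap v (zeta i) k = tap v' (zeta i) k) -> forall k, v k = v' k.
Proof.
move=> Uz tv tv' vv'; elim/ltn_ind => k IH.
have [_ _ inj] := czeta.
apply/eqP; rewrite -subr_eq0; apply/eqP; apply: (inj z Uz).
  by apply: tangentD => //; exact: tangentN.
move=> i; change (v k (zeta i 0%N) - v' k (zeta i 0%N) = 0).
have := vv' i k; rewrite !tapE.
rewrite (eq_bigr (fun a : 'I_k => v' a (zeta i (k - a)%N))) => [/addrI ->|a _].
  exact: subrr.
by rewrite IH.
Qed.

(** [E g] is the formal field with components [g]. It is defined for arbitrary [g] and is smooth
    wherever [g] is, so a single [E] serves all open subsets of [U]. *)
Lemma formal_frame : exists E : ('I_q -> tfunc M) -> tfield M,
  [/\ forall (g : 'I_q -> tfunc M) k z, tangent z (E g k z),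
      forall (g : 'I_q -> tfunc M) k z i, U z -> tapp (E g) (zeta i) k z = g i k z,
      forall (g : 'I_q -> tfunc M) V, open V -> V `<=` U ->
        (forall i, is_tfunc V (g i)) -> is_tfield V (E g)
    & forall (g : 'I_q -> tfunc M) k z, ~ U z -> E g k z = 0].
Proof.
have [oU _ _] := czeta.
have [e [te eE fe e0]] := coordinate_frame qn czeta.
(* [cf] is the part of the prescribed order [k] component that the lower coefficients leave over; it
   is expanded in the order-zero frame. *)
pose cf (g : 'I_q -> tfunc M) k (X : tfield M) i : cfunc M := fun z =>
  g i k z - \sum_(a < k) X a z (zeta i (k - a)%N).
pose F (g : 'I_q -> tfunc M) k (X : tfield M) : vfield M :=
  \sum_i fscale (cf g k X i) (e i).
have /choice[E EE] : forall g : 'I_q -> tfunc M, exists X, forall k, X k = F g k X.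
  move=> g; apply: (prefix_recursion 0) => k X Y XY.
  rewrite /F; apply: eq_bigr => i _; congr fscale; apply/funext => z.
  by rewrite /cf; congr (_ - _); apply: eq_bigr => a _; rewrite XY.
have EkE (g : 'I_q -> tfunc M) k z h : E g k z h = \sum_i cf g k (E g) i z * e i z h.
  by rewrite EE /F !fct_sumE.
have tE (g : 'I_q -> tfunc M) k z : tangent z (E g k z).
  rewrite EE /F fct_sumE; apply: tangent_sum => i _; exact/tangentZ/te.
exists E; split=> //.
- move=> g k z i Uz; rewrite tappE tapE EkE (bigD1 i)//= [X in _ + (_ + X)]big1 => [|j ji].
    by rewrite eE// eqxx mulr1 addr0 /cf addrC subrK.
  by rewrite eE// (negbTE ji) mulr0.
- move=> g V oV VU sg; elim/ltn_ind => k IH; rewrite EE.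
  apply: is_field_sum => i _; apply: is_field_scale; last first.
    by apply: is_field_sub (fe i).
  apply: smoothB => //; first exact: sg.
  apply: smooth_sum => // a _; have [_ sX] := IH a (ltn_ord a).
  by apply: (sX V) => //; apply: smooth_sub (szeta i _).
- by move=> g k z nUz; apply/funext => h; rewrite EkE big1// => i _; rewrite e0// mulr0.
Qed.

End FormalFrame.

End FormalCalculus.

(** * The local connections *)

Section MoreFormal.
Variables (R : realType) (n : nat) (M : smoothManifold R n).
Implicit Types (U V : set M) (f g : tfunc M) (X Y Z : tfield M) (x z : M).

Lemma tmulC f g k z : tmul f g k z = tmul g f k z.
Proof. by rewrite /tmul convC; apply: eq_conv => i j; rewrite mulrC. Qed.

Lemma tmul_eq f f' g g' k z : (forall k, f k z = f' k z) ->
  (forall k, g k z = g' k z) -> tmul f g k z = tmul f' g' k z.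
Proof. by move=> ff' gg'; apply: eq_conv => i j; rewrite ff' gg'. Qed.

Lemma tmul0l f g k z : (forall k, f k z = 0) -> tmul f g k z = 0.
Proof. by move=> f0; rewrite /tmul /conv big1// => i _; rewrite f0 mul0r. Qed.

Lemma tmul0r f g k z : (forall k, g k z = 0) -> tmul f g k z = 0.
Proof. by move=> g0; rewrite tmulC tmul0l. Qed.

Lemma tmul1r f g k z : (forall k, g k z = (k == 0%N)%:R) -> tmul f g k z = f k z.
Proof.
move=> g1; rewrite /tmul /conv big_ord_recr /= subnn g1 mulr1 big1 ?add0r// => i _.
by rewrite g1 subn_eq0 leqNgt ltn_ord mulr0.
Qed.

Lemma tapp_sub U X f g k z : open U -> U z -> is_tfield U X -> is_tfunc U f ->
  is_tfunc U g ->
  tapp X (fun k y => f k y - g k y) k z = tapp X f k z - tapp X g k z.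
Proof.
move=> oU Uz fX sf sg; apply/eqP; rewrite eq_sym subr_eq; apply/eqP.
rewrite -(tapp_addr (U := U))//; last by move=> i; exact: smoothB.
by apply: (tapp_eq (U := U)) => // i y _; rewrite subrK.
Qed.

Lemma tapp_sum U X (I : Type) (r : seq I) (F : I -> tfunc M) k z :
  open U -> U z -> is_tfield U X -> (forall i, is_tfunc U (F i)) ->
  tapp X (fun k y => \sum_(i <- r) F i k y) k z = \sum_(i <- r) tapp X (F i) k z.
Proof.
move=> oU Uz fX sF; rewrite tappE /tap.
rewrite (eq_conv (G := fun a b => \sum_(i <- r) X a z (F i b))) => [|a b].
  by rewrite conv_big; apply: eq_bigr => i _; rewrite tappE.
have [tX _] := fX a; rewrite (tangent_vsum (tX z Uz))// => i.
by exists U; split=> //; exact: sF.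
Qed.

Lemma tapp_zero U X f k z : open U -> U z -> is_tfield U X -> is_tfunc U f ->
  (forall k y, U y -> f k y = 0) -> tapp X f k z = 0.
Proof.
move=> oU Uz fX sf f0; rewrite -(tapp0 k Uz fX).
exact: (tapp_eq (U := U)).
Qed.

(** Here [s] and [t] are the orders of the two coordinate functions, [b] and [c] those of the two
    fields. The regrouping pairs each field with the function it differentiates. *)
Lemma conv4 (A : nmodType) (G : nat -> nat -> nat -> nat -> A) :
  conv (fun l c => conv (fun a b => conv (fun s t => G s t b c) a) l) =1
  conv (fun p r => conv (fun t c => conv (fun b s => G s t b c) p) r).
Proof.
move=> k; rewrite (eq_conv (G := fun l c =>
    conv (fun p t => conv (fun b s => G s t b c) p) l)) => [|l c].
  by rewrite -convA.
rewrite -convA (eq_conv (G := fun s l => conv (fun b t => G s t b c) l)) => [|s m].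
  by rewrite convA; apply: eq_conv => p t; exact: convC.
exact: convC.
Qed.

Lemma conv_mul (A : pzSemiRingType) (F G : nat -> nat -> A) k :
  conv (fun p r => conv F p * conv G r) k =
  conv (fun p r => conv (fun t c => conv (fun b s => F b s * G c t) p) r) k.
Proof.
apply: eq_conv => p r; rewrite [conv G r]convC conv_mulr; apply: eq_conv => t c.
by rewrite /conv mulr_suml.
Qed.

End MoreFormal.

Section Darboux.
Variables (R : realType) (n : nat) (M : smoothManifold R n).
Variables (w : tform M) (P : set M -> set (tfield M)).
Hypotheses (w_nondeg : Defs.nondegenerate (w 0%N)).
Implicit Types (U V : set M) (f g : tfunc M) (X Y Z : tfield M).
Local Notation m := (n./2).

Record darboux U (x y : 'I_m -> tfunc M) : Prop := Darboux {
  darboux_open : open U;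
  darboux_x : forall i, is_tfunc U (x i);
  darboux_y : forall i, is_tfunc U (y i);
  darboux_form : forall k, eq_form_on U (w k) (\sum_i tdwedge (y i) (x i) k);
  darboux_P : forall V X, open V -> V `<=` U ->
    P V X <-> is_tfield V X /\ forall i k z, V z -> tapp X (x i) k z = 0 }.

(** Tangency at every point for arbitrary arguments, together with the value 0 off [U], lets the
    global sum range over all charts without asking whether the point lies in them. *)
Record local_connection U (x y : 'I_m -> tfunc M)
    (D : tfield M -> tfield M -> tfield M) : Prop := LocalConnection {
  lc_tangent : forall X Y k z, tangent z (D X Y k z);
  lc_x : forall X Y i k z, U z -> tapp (D X Y) (x i) k z = tapp X (tapp Y (x i)) k z;
  lc_y : forall X Y i k z, U z -> tapp (D X Y) (y i) k z = tapp X (tapp Y (y i)) k z;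
  lc_field : forall V X Y, open V -> V `<=` U -> is_tfield V X -> is_tfield V Y ->
    is_tfield V (D X Y);
  lc_out : forall X Y k z, ~ U z -> D X Y k z = 0 }.

Definition join_coords (x y : 'I_m -> tfunc M) (i : 'I_(m + m)) : tfunc M :=
  match fintype.split i with inl j => x j | inr j => y j end.

Lemma join_coordsl x y i : join_coords x y (lshift m i) = x i.
Proof. by rewrite /join_coords -[lshift m i]/(unsplit (inl i)) unsplitK. Qed.

Lemma join_coordsr x y i : join_coords x y (rshift m i) = y i.
Proof. by rewrite /join_coords -[rshift m i]/(unsplit (inr i)) unsplitK. Qed.

Lemma join_coordsP x y (Q : tfunc M -> Prop) i :
  (forall i, Q (x i)) -> (forall i, Q (y i)) -> Q (join_coords x y i).
Proof. by move=> Qx Qy; rewrite /join_coords; case: fintype.split. Qed.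

Lemma half_addn_leq : (m + m <= n)%N.
Proof. by rewrite addnn -[leqRHS]odd_double_half leq_addl. Qed.

Section Chart.
Variables (U : set M) (x y : 'I_m -> tfunc M) (dU : darboux U x y).

Lemma darboux_pair Y Z k z : U z -> (forall k, tangent z (Y k z)) ->
  (forall k, tangent z (Z k z)) ->
  tpair w Y Z k z = \sum_i (tmul (tapp Y (y i)) (tapp Z (x i)) k z
                            - tmul (tapp Y (x i)) (tapp Z (y i)) k z).
Proof.
move=> Uz tY tZ; rewrite tpairE.
pose G i s t b c := Y b z (y i s) * Z c z (x i t).
pose H i s t b c := Y b z (x i t) * Z c z (y i s).
have wE a b c : w a z (Y b z) (Z c z) =
    \sum_i conv (fun s t => G i s t b c - H i s t b c) a.
  rewrite (darboux_form dU)// !fct_sumE; apply: eq_bigr => i _.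
  by rewrite tdwedgeE; apply: eq_conv => s t; rewrite /G /H [X in _ - X]mulrC.
rewrite (eq_conv (G := fun l c => \sum_i conv (fun a b =>
    conv (fun s t => G i s t b c - H i s t b c) a) l)) => [|l c]; last first.
  by rewrite -conv_big; apply: eq_conv.
rewrite conv_big; apply: eq_bigr => i _; apply/esym/eqP; rewrite subr_eq; apply/eqP.
transitivity (conv (fun l c => conv (fun a b => conv (fun s t => G i s t b c) a) l) k).
  rewrite conv4 /tmul -conv_mul; apply: eq_conv => p r.
  by rewrite !tappE.
have -> : tmul (tapp Y (x i)) (tapp Z (y i)) k z =
    conv (fun l c => conv (fun a b => conv (fun s t => H i s t b c) a) l) k.
  (* In [H] the field [Y] meets [x i], so the orders of [x i] and [y i] are exchanged to reach the
     shape of [conv4]. *)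
  rewrite (eq_conv (G := fun l c => conv (fun a b => conv (fun s t => H i t s b c) a) l)).
    rewrite conv4 /tmul -conv_mul; apply: eq_conv => p r.
    by rewrite !tappE.
  by move=> l c; apply: eq_conv => a b; exact: convC.
rewrite -convD; apply: eq_conv => l c; rewrite -convD; apply: eq_conv => a b.
by rewrite -convD; apply: eq_conv => s t; rewrite subrK.
Qed.

Lemma darboux_coordinates : coordinates U (fun i => join_coords x y i 0%N).
Proof.
split; first exact: darboux_open dU.
  move=> i; apply: (join_coordsP i (Q := fun f => smooth U (f 0%N))) => j.
    exact: (darboux_x dU j 0%N).
  exact: (darboux_y dU j 0%N).
move=> z Uz v tv v0; apply: (w_nondeg tv) => v' tv'.
rewrite (darboux_form dU)// !fct_sumE big1// => i _.
rewrite tdwedgeE conv0.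
have := v0 (lshift m i); have := v0 (rshift m i).
by rewrite join_coordsl join_coordsr => -> ->; rewrite mul0r mulr0 subr0.
Qed.

Lemma darboux_tfunc i : is_tfunc U (join_coords x y i).
Proof.
by apply: join_coordsP => j; [exact: (darboux_x dU)|exact: (darboux_y dU)].
Qed.

Lemma darboux_inj z (v v' : nat -> tvec M) : U z ->
  (forall k, tangent z (v k)) -> (forall k, tangent z (v' k)) ->
  (forall i k, tap v (x i) k = tap v' (x i) k) ->
  (forall i k, tap v (y i) k = tap v' (y i) k) -> forall k, v k = v' k.
Proof.
move=> Uz tv tv' ex ey; apply: (formal_tangent_inj darboux_coordinates Uz tv tv').
by move=> i; apply: (join_coordsP i (Q := fun f => forall k, tap v f k = tap v' f k)).
Qed.

Lemma local_connection_exists : exists D, local_connection U x y D.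
Proof.
have [E [tE EE fE E0]] :=
  formal_frame half_addn_leq darboux_tfunc darboux_coordinates.
exists (fun X Y => E (fun i => tapp X (tapp Y (join_coords x y i)))); split=> //.
- by move=> X Y i k z Uz; rewrite -(join_coordsl x y i) EE// join_coordsl.
- by move=> X Y i k z Uz; rewrite -(join_coordsr x y i) EE// join_coordsr.
- move=> V X Y oV VU fX fY; apply: fE => // i.
  do 2!apply: is_tfunc_tapp => //.
  by apply: is_tfunc_sub (darboux_tfunc i).
- by move=> X Y k z nUz; exact: E0.
Qed.

(** [Z] is the coordinate field of [x j]. In [bott_unique], pairing a field with it reads off that
    field's [y j] component. *)
Lemma darboux_dual (j : 'I_m) : exists Z, [/\ is_tfield U Z,
  forall i k z, U z -> tapp Z (x i) k z = if i == j then (k == 0%N)%:R else 0 &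
  forall i k z, U z -> tapp Z (y i) k z = 0].
Proof.
have [E [tE EE fE E0]] :=
  formal_frame half_addn_leq darboux_tfunc darboux_coordinates.
pose g i : tfunc M := fun k _ => if i == lshift m j then (k == 0%N)%:R else 0.
exists (E g); split.
- by apply: fE => //; [exact: darboux_open dU|move=> i k; exact: smooth_cst].
- by move=> i k z Uz; rewrite -(join_coordsl x y i) EE// /g eq_lshift.
- by move=> i k z Uz; rewrite -(join_coordsr x y i) EE// /g eq_rlshift.
Qed.

End Chart.

End Darboux.

Section LocalConnection.
Variables (R : realType) (n : nat) (M : smoothManifold R n).
Variables (w : tform M) (P : set M -> set (tfield M)).
Hypotheses (w_nondeg : Defs.nondegenerate (w 0%N)).
Implicit Types (U V W : set M) (f g : tfunc M) (X Y Z T : tfield M).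
Local Notation m := (n./2).

Definition coord (x y : 'I_m -> tfunc M) f :=
  (exists i, f = x i) \/ (exists i, f = y i).

Variables (U : set M) (x y : 'I_m -> tfunc M) (D : tfield M -> tfield M -> tfield M).
Hypotheses (dU : darboux w P U x y) (lD : local_connection U x y D).

Lemma coord_tfunc W f : W `<=` U -> coord x y f -> is_tfunc W f.
Proof.
move=> WU [[i ->]|[i ->]]; apply: is_tfunc_sub WU _.
  exact: (darboux_x dU).
exact: (darboux_y dU).
Qed.

Lemma lc_tapp X Y f k z : U z -> coord x y f ->
  tapp (D X Y) f k z = tapp X (tapp Y f) k z.
Proof. by move=> Uz [[i ->]|[i ->]]; [exact: (lc_x lD)|exact: (lc_y lD)]. Qed.

Lemma tfield_eq X Y z : U z -> (forall k, tangent z (X k z)) ->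
  (forall k, tangent z (Y k z)) ->
  (forall f k, coord x y f -> tapp X f k z = tapp Y f k z) ->
  forall k, X k z = Y k z.
Proof.
move=> Uz tX tY e; apply: (darboux_inj w_nondeg dU Uz tX tY) => i k.
  by rewrite -!tappE; apply: e; left; exists i.
by rewrite -!tappE; apply: e; right; exists i.
Qed.

(** Identities for [D] are checked by letting both sides act on the coordinate functions, where
    [D X Y] acts as [X] after [Y]. *)
Lemma lc_eq X Y T z : U z -> (forall k, tangent z (T k z)) ->
  (forall f k, coord x y f -> tapp T f k z = tapp X (tapp Y f) k z) ->
  forall k, D X Y k z = T k z.
Proof.
move=> Uz tT e; apply: tfield_eq => //; first by move=> k; exact: (lc_tangent lD).
by move=> f k cf; rewrite e// lc_tapp.
Qed.

Lemma tangent_tscale f X k z : (forall k, tangent z (X k z)) ->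
  tangent z (tscale f X k z).
Proof.
move=> tX; rewrite /tscale /Defs.cauchy fct_sumE.
by apply: tangent_sum => i _; exact: tangentZ.
Qed.

Section At.
Variables (W : set M) (z : M).
Hypotheses (oW : open W) (Wz : W z).

Let oWU : open (W `&` U).
Proof. by apply: openI => //; exact: darboux_open dU. Qed.

Let tang X k : is_tfield W X -> tangent z (X k z).
Proof. by move=> fX; have [tX _] := fX k; exact: tX. Qed.

Let fWU X : is_tfield W X -> is_tfield (W `&` U) X.
Proof. by apply: is_tfield_sub => ? []. Qed.

Let cWU f : coord x y f -> is_tfunc (W `&` U) f.
Proof. by apply: coord_tfunc => ? []. Qed.

(** Off [U] both sides are 0 by [lc_out]. At a point of [U] the fields, known to be smooth only on
    [W], are compared on the intersection of [W] and [U]. *)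
Lemma lc_local X X' Y Y' k : is_tfield W X -> is_tfield W X' -> is_tfield W Y ->
  is_tfield W Y' -> eq_tfield_on W X X' -> eq_tfield_on W Y Y' ->
  D X Y k z = D X' Y' k z.
Proof.
move=> fX fX' fY fY' XX' YY'; have [Uz|nUz] := pselect (U z); last by rewrite !(lc_out lD).
apply: lc_eq => // [j|f j cf]; first exact: (lc_tangent lD).
rewrite lc_tapp//; apply/esym.
apply: (tapp_eq (U := W `&` U)) => //; [exact: fWU|exact: is_tfunc_tapp (fWU fY) (cWU cf)| |].
  move=> l v [Wv Uv]; apply: (tapp_eq (U := W `&` U)) => //; [exact: fWU|exact: cWU|].
  by move=> a; rewrite YY'.
by move=> a; rewrite XX'.
Qed.

Lemma lc_addl X X' Y k : D (X + X') Y k z = D X Y k z + D X' Y k z.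
Proof.
have [Uz|nUz] := pselect (U z); last by rewrite !(lc_out lD)// addr0.
apply: (lc_eq (T := D X Y + D X' Y)) => // [j|f j cf].
  by apply: tangentD; exact: (lc_tangent lD).
by rewrite !tapp_addl !lc_tapp.
Qed.

Lemma lc_addr X Y Y' k : is_tfield W X -> is_tfield W Y -> is_tfield W Y' ->
  D X (Y + Y') k z = D X Y k z + D X Y' k z.
Proof.
move=> fX fY fY'; have [Uz|nUz] := pselect (U z); last by rewrite !(lc_out lD)// addr0.
apply: (lc_eq (T := D X Y + D X Y')) => // [j|f j cf].
  by apply: tangentD; exact: (lc_tangent lD).
have [sY sY'] : is_tfunc (W `&` U) (tapp Y f) /\ is_tfunc (W `&` U) (tapp Y' f).
  by split; apply: is_tfunc_tapp => //; [exact: fWU|exact: cWU|exact: fWU|exact: cWU].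
rewrite tapp_addl !lc_tapp// -(tapp_addr (U := W `&` U))//; last exact: fWU.
by congr (tapp X _ j z); apply/funext => l; apply/funext => v; rewrite tapp_addl.
Qed.

Lemma lc_scalel f X Y k : D (tscale f X) Y k z = tscale f (D X Y) k z.
Proof.
have [Uz|nUz] := pselect (U z); last first.
  rewrite !(lc_out lD)//; apply/funext => h.
  by rewrite tscaleE /conv big1// => i _; rewrite (lc_out lD)// mulr0.
apply: lc_eq => // [j|g j cg]; first by apply: tangent_tscale => l; exact: (lc_tangent lD).
rewrite !tapp_scale; apply: tmul_eq => // l; exact: lc_tapp.
Qed.

(** The point must lie in [U]: elsewhere [D] is 0 while the term with [X f] need not be. The same
    holds for compatibility with [w] and for torsion; the weights of the partition restore all three
    globally. *)
Lemma lc_leibniz f X Y k : U z -> is_tfunc W f -> is_tfield W X -> is_tfield W Y ->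
  D X (tscale f Y) k z = tscale (tapp X f) Y k z + tscale f (D X Y) k z.
Proof.
move=> Uz sf fX fY; apply: (lc_eq (T := tscale (tapp X f) Y + tscale f (D X Y))) => //.
  move=> j; apply: tangentD; apply: tangent_tscale => l; first exact: tang.
  exact: (lc_tangent lD).
move=> g j cg; rewrite tapp_addl !tapp_scale.
have -> : tapp (tscale f Y) g = tmul f (tapp Y g).
  by apply/funext => l; apply/funext => v; rewrite tapp_scale.
rewrite (tappM (U := W `&` U))//; [|exact: fWU| |].
- by congr (_ + _); apply: tmul_eq => // l; exact: lc_tapp.
- by apply: is_tfunc_sub sf => ? [].
- by apply: is_tfunc_tapp => //; [exact: fWU|exact: cWU].
Qed.

(** In Darboux coordinates [w] is bilinear in the components with constant coefficients, and [D]
    differentiates components, so this is the product rule. *)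
Lemma lc_form X Y Z k : U z -> is_tfield W X -> is_tfield W Y -> is_tfield W Z ->
  tapp X (tpair w Y Z) k z = tpair w (D X Y) Z k z + tpair w Y (D X Z) k z.
Proof.
move=> Uz fX fY fZ.
pose F i : tfunc M := fun k v => tmul (tapp Y (y i)) (tapp Z (x i)) k v
  - tmul (tapp Y (x i)) (tapp Z (y i)) k v.
have cx i : coord x y (x i) by left; exists i.
have cy i : coord x y (y i) by right; exists i.
have sapp T f : is_tfield W T -> coord x y f -> is_tfunc (W `&` U) (tapp T f).
  by move=> fT cf; apply: is_tfunc_tapp => //; [exact: fWU|exact: cWU].
have sF i : is_tfunc (W `&` U) (F i).
  by move=> l; apply: smoothB => //; apply: is_tfunc_tmul => //; exact: sapp.
have lcT X' Y' l : tangent z (D X' Y' l z) by exact: (lc_tangent lD).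
transitivity (tapp X (fun k v => \sum_i F i k v) k z).
  apply/esym/(tapp_eq (U := W `&` U)) => //; [exact: fWU| |].
    by move=> l; apply: smooth_sum => // i _; exact: sF.
  move=> l v [Wv Uv]; rewrite (darboux_pair dU)// => a.
    by have [tY _] := fY a; exact: tY.
  by have [tZ _] := fZ a; exact: tZ.
rewrite (tapp_sum (U := W `&` U))//; last exact: fWU.
rewrite (darboux_pair dU k Uz) => // [|a]; last exact: tang.
rewrite (darboux_pair dU k Uz) => // [|a]; last exact: tang.
rewrite -big_split; apply: eq_bigr => i _ /=.
rewrite (tapp_sub (U := W `&` U))//; last 3 first.
- exact: fWU.
- by apply: is_tfunc_tmul => //; exact: sapp.
- by apply: is_tfunc_tmul => //; exact: sapp.
rewrite !(tappM (U := W `&` U))//; try exact: fWU; try exact: sapp.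
have e T f g : coord x y f -> tmul (tapp X (tapp T f)) g k z = tmul (tapp (D X T) f) g k z.
  by move=> cf; apply: tmul_eq => // l; rewrite lc_tapp.
have e' T f g : coord x y g -> tmul f (tapp X (tapp T g)) k z = tmul f (tapp (D X T) g) k z.
  by move=> cg; apply: tmul_eq => // l; rewrite lc_tapp.
by rewrite !e// !e'// opprD addrACA.
Qed.

Lemma lc_torsion X Y k : U z -> is_tfield W X -> is_tfield W Y ->
  D X Y k z - D Y X k z = tbracket X Y k z.
Proof.
move=> Uz fX fY; apply/eqP; rewrite subr_eq; apply/eqP.
apply: (lc_eq (T := tbracket X Y + D Y X)) => // [j|f j cf].
  apply: tangentD; last exact: (lc_tangent lD).
  by apply: tang; exact: is_tfield_bracket.
rewrite tapp_addl lc_tapp// (tapp_bracket (U := W `&` U)) ?subrK//; try exact: fWU.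
exact: cWU.
Qed.

End At.

Lemma lc_P V X Y : open V -> V `<=` U -> is_tfield V X -> P V Y -> P V (D X Y).
Proof.
move=> oV VU fX /(darboux_P dU _ oV VU)[fY Y0]; apply/(darboux_P dU _ oV VU).
split=> [|i k z Vz]; first exact: (lc_field lD).
have cx : coord x y (x i) by left; exists i.
rewrite lc_tapp//; last exact: VU.
apply: (tapp_zero (U := V)) => //; first by apply: is_tfunc_tapp => //; exact: coord_tfunc cx.
by move=> l v Vv; exact: Y0.
Qed.

(** Each term of [w] in Darboux coordinates carries a factor [dx_i], which vanishes on [P]. *)
Lemma P_isotropic V Y Z k z : open V -> V `<=` U -> P V Y -> P V Z -> V z ->
  tpair w Y Z k z = 0.
Proof.
move=> oV VU /(darboux_P dU _ oV VU)[fY Y0] /(darboux_P dU _ oV VU)[fZ Z0] Vz.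
rewrite (darboux_pair dU k (VU z Vz)); last 2 first.
- by move=> a; have [tY _] := fY a; exact: tY.
- by move=> a; have [tZ _] := fZ a; exact: tZ.
rewrite big1// => i _.
by rewrite tmul0r ?tmul0l ?subrr// => l; [exact: Y0|exact: Z0].
Qed.

Lemma P_bracket V X Y : open V -> V `<=` U -> P V X -> P V Y -> P V (tbracket X Y).
Proof.
move=> oV VU /(darboux_P dU _ oV VU)[fX X0] /(darboux_P dU _ oV VU)[fY Y0].
apply/(darboux_P dU _ oV VU); split=> [|i k z Vz]; first exact: is_tfield_bracket.
have cx : is_tfunc V (x i) by apply: coord_tfunc => //; left; exists i.
rewrite (tapp_bracket (U := V))// !(tapp_zero (U := V)) ?subrr//.
- exact: is_tfunc_tapp.
- by move=> l v; exact: X0.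
- exact: is_tfunc_tapp.
- by move=> l v; exact: Y0.
Qed.

End LocalConnection.

(** * Uniqueness of the connection on P along P *)

Section Bott.
Variables (R : realType) (n : nat) (M : smoothManifold R n).
Variables (w : tform M) (P : set M -> set (tfield M)).
Hypotheses (w_nondeg : Defs.nondegenerate (w 0%N)).
Hypothesis w_2form : forall k, is_2form (w k).
Implicit Types (U V W : set M) (f g : tfunc M) (X Y Z T : tfield M).

Lemma form_addr a z u v v' : tangent z u -> tangent z v -> tangent z v' ->
  w a z u (v + v') = w a z u v + w a z u v'.
Proof.
move=> tu tv tv'; have tvv' := tangentD tv tv'.
rewrite (form_antisym (w_2form a) tu tvv').
have -> : v + v' = (fun h => 1 * v h + v' h) by apply/funext => h; rewrite mul1r.
rewrite (form_linear (w_2form a))// mul1r opprD.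
by rewrite -(form_antisym (w_2form a) tu tv) -(form_antisym (w_2form a) tu tv').
Qed.

(* On [P] along [P] a connection preserving [w] and [P] without torsion is
   determined by [w (nabla_X Y, Z) = X (w (Y, Z)) - w (Y, [X, Z])], because
   [w (Y, nabla_Z X) = 0]. *)
Lemma bott_unique U x y D U' x' y' D' V X Y k z :
  darboux w P U x y -> local_connection U x y D ->
  darboux w P U' x' y' -> local_connection U' x' y' D' ->
  (forall V V' X, open V -> open V' -> V' `<=` V -> P V X -> P V' X) ->
  open V -> V `<=` U' -> P V X -> P V Y -> V z -> U z ->
  D X Y k z = D' X Y k z.
Proof.
move=> dU lD dU' lD' Prestrict oV VU' PX PY Vz Uz.
have oU : open U := darboux_open dU.
wlog VU : V oV VU' PX PY Vz / V `<=` U.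
  have oVU : open (V `&` U) by exact: openI.
  have VUV : V `&` U `<=` V by move=> ? [].
  move=> H; apply: (H (V `&` U)) => //.
  - by move=> v /VUV/VU'.
  - exact: Prestrict PX.
  - exact: Prestrict PY.
have [fX X0] := (darboux_P dU' _ oV VU').1 PX.
have [fY Y0] := (darboux_P dU' _ oV VU').1 PY.
have U'z := VU' z Vz.
have pairE W D0 x0 y0 T : darboux w P W x0 y0 -> local_connection W x0 y0 D0 ->
    V `<=` W -> is_tfield V T -> forall l,
    tpair w (D0 X Y) T l z = tapp X (tpair w Y T) l z - tpair w Y (tbracket X T) l z.
  move=> dW lD0 VW fT l.
  rewrite (lc_form dW lD0 oV Vz l (VW z Vz) fX fY fT).
  have -> : tpair w Y (tbracket X T) l z = tpair w Y (D0 X T) l z.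
    have e j : D0 X T j z = tbracket X T j z + D0 T X j z.
      by rewrite -(lc_torsion w_nondeg dW lD0 oV Vz j (VW z Vz) fX fT) subrK.
    (* [D0 T X] remains in [P], so the zero added here is its pairing with [Y]; absence of torsion
       then turns the bracket into [D0 X T]. *)
    rewrite -[LHS]addr0 -(P_isotropic dW l oV VW PY (lc_P dW lD0 oV VW fT PX) Vz) !tpairE -convD.
    apply: eq_conv => a c; rewrite -convD; apply: eq_conv => b d; rewrite e form_addr//.
    - by have [tY _] := fY d; exact: tY.
    - by have [tT _] := is_tfield_bracket oV fX fT c; exact: tT.
    - exact: (lc_tangent lD0).
  by rewrite addrK.
apply: (tfield_eq w_nondeg dU' U'z).
- by move=> j; exact: (lc_tangent lD).
- by move=> j; exact: (lc_tangent lD').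
(* Both derivatives lie in [P], so their [x' i] components vanish. Their [y' i] components are
   pairings with the field dual to [x' i], which [pairE] computes without reference to the
   connection. *)
move=> f l [[i ->]|[i ->]].
  have [_ D'0] := (darboux_P dU' _ oV VU').1 (lc_P dU' lD' oV VU' fX PY).
  have [_ D0] := (darboux_P dU' _ oV VU').1 (lc_P dU lD oV VU fX PY).
  by rewrite D0 ?D'0.
have [Z [fZ Zx Zy]] := darboux_dual w_nondeg dU' i.
have fZV : is_tfield V Z by apply: is_tfield_sub fZ.
have tZ j : tangent z (Z j z) by have [tZ _] := fZV j; exact: tZ.
have E D0 : (forall j, tangent z (D0 X Y j z)) ->
    tpair w (D0 X Y) Z l z = tapp (D0 X Y) (y' i) l z.
  move=> tD0; rewrite (darboux_pair dU' l U'z)// (bigD1 i)//= big1 => [|j ji].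
    rewrite tmul1r => [|j]; last by rewrite Zx// eqxx.
    by rewrite tmul0r ?subr0 ?addr0// => j; exact: Zy.
  rewrite tmul0r ?tmul0r ?subrr// => a; first exact: Zy.
  by rewrite Zx// (negbTE ji).
rewrite -!E; try by move=> j; exact: (lc_tangent lD) || exact: (lc_tangent lD').
by rewrite (pairE U D x y)// (pairE U' D' x' y').
Qed.

End Bott.

(** * The global connection *)

Section Gluing.
Variables (R : realType) (n : nat) (M : smoothManifold R n).
Variables (w : tform M) (P : set M -> set (tfield M)).
Implicit Types (U V W : set M) (f g : tfunc M) (X Y Z T : tfield M).
Local Notation m := (n./2).
Hypotheses (w_nondeg : Defs.nondegenerate (w 0%N))
  (w_2form : forall k, is_2form (w k))
  (P_field : forall U X, open U -> P U X -> is_tfield U X)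
  (P_restrict : forall U V X, open U -> open V -> V `<=` U -> P U X -> P V X)
  (P_glue : forall U X, open U ->
    (forall x, U x -> exists V : set M, [/\ open V, V x, V `<=` U & P V X]) -> P U X)
  (P_local : forall z : M, exists U x y, darboux w P U x y /\ U z).

Section Nabla.
Variables (U S W : nat -> set M) (p : nat -> cfunc M)
  (x y : nat -> 'I_m -> tfunc M) (D : nat -> tfield M -> tfield M -> tfield M)
  (N : M -> nat).
Hypotheses (dU : forall a, darboux w P (U a) (x a) (y a))
  (lD : forall a, local_connection (U a) (x a) (y a) (D a))
  (cS : forall a, closed (S a)) (SU : forall a, S a `<=` U a)
  (sp : forall a, smooth setT (p a)) (p0 : forall a z, ~ S a z -> p a z = 0)
  (oW : forall j, open (W j)) (WN : forall z, W (N z) z)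
  (pW0 : forall j a z, W j z -> (j < a)%N -> p a z = 0)
  (pW1 : forall j z, W j z -> \sum_(a < j.+1) p a z = 1).

(** [N z] is some index whose set [W] contains [z], chosen without continuity. Weights beyond it
    vanish at [z], so the cutoff does not affect the value; see [sum_partition]. *)
Definition nabla X Y : tfield M := fun k z =>
  \sum_(a < (N z).+1) tvscale (p a z) (D a X Y k z).

Lemma sum_partition (F : nat -> R[i]) j z : W j z ->
  \sum_(a < (N z).+1) p a z * F a = \sum_(a < j.+1) p a z * F a.
Proof.
have stable i l : W i z -> (i <= l)%N ->
    \sum_(a < l.+1) p a z * F a = \sum_(a < i.+1) p a z * F a.
  move=> Wi il; rewrite -!(big_mkord xpredT (fun a => p a z * F a)).
  rewrite (@big_cat_nat _ _ _ i.+1)//= [X in _ + X]big_nat_cond.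
  rewrite [X in _ + X]big1 ?addr0// => a /andP[/andP[ia _] _].
  by rewrite (pW0 Wi ia) mul0r.
move=> Wj; have [Nj|/ltnW jN] := leqP (N z) j; first by rewrite -(stable _ _ (WN z) Nj).
exact: stable.
Qed.

Lemma p_neq0 a z : ~ U a z -> p a z = 0.
Proof. by move=> nU; apply: p0 => /SU. Qed.

(** The gluing principle: weights of total 1 preserve a value common to all charts through [z], and
    the other charts have weight 0. *)
Lemma affine (F : nat -> R[i]) c z : (forall a, U a z -> F a = c) ->
  \sum_(a < (N z).+1) p a z * F a = c.
Proof.
move=> Fc; rewrite (eq_bigr (fun a : 'I_(N z).+1 => p a z * c)) => [|a _].
  by rewrite -mulr_suml pW1 ?mul1r.
by have [/Fc -> //|/p_neq0 ->] := pselect (U a z); rewrite !mul0r.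
Qed.

Lemma nablaE X Y k z h :
  nabla X Y k z h = \sum_(a < (N z).+1) p a z * D a X Y k z h.
Proof. by rewrite /nabla fct_sumE. Qed.

Lemma nabla_affine X Y T k z : (forall a, U a z -> D a X Y k z = T k z) ->
  nabla X Y k z = T k z.
Proof.
move=> e; apply/funext => h; rewrite nablaE.
by apply: (affine (F := fun a => D a X Y k z h)) => a /e ->.
Qed.

Lemma tangent_nabla X Y k z : tangent z (nabla X Y k z).
Proof.
by apply: tangent_sum => a _; apply: tangentZ; exact: (lc_tangent (lD a)).
Qed.

Lemma tapp_nabla X Y f k z :
  tapp (nabla X Y) f k z = \sum_(a < (N z).+1) p a z * tapp (D a X Y) f k z.
Proof.
rewrite tappE /tap (eq_conv (G := fun i j =>
    \sum_(a < (N z).+1) p a z * D a X Y i z (f j))) => [|i j]; last exact: nablaE.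
by rewrite conv_big; apply: eq_bigr => a _; rewrite tappE conv_mulr.
Qed.

Lemma form_sum k z (I : Type) (r : seq I) (c : I -> R[i]) (v : I -> tvec M) v' :
  (forall i, tangent z (v i)) -> tangent z v' ->
  w k z (\sum_(i <- r) tvscale (c i) (v i)) v' = \sum_(i <- r) c i * w k z (v i) v'.
Proof.
move=> tv tv'; elim: r => [|i r IH].
  rewrite !big_nil.
  have := form_linear (w_2form k) 1 (tangent0 z) (tangent0 z) tv'.
  rewrite (_ : (fun h => _) = 0); last by apply/funext => h; rewrite /= mulr0 addr0.
  by rewrite mul1r -[LHS]addr0 => /addrI/esym.
rewrite !big_cons -IH -(form_linear (w_2form k))//.
by apply: tangent_sum => j _; exact: tangentZ.
Qed.

Lemma pair_nablal X Y Z k z : (forall k, tangent z (Z k z)) ->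
  tpair w (nabla X Y) Z k z = \sum_(a < (N z).+1) p a z * tpair w (D a X Y) Z k z.
Proof.
move=> tZ; rewrite tpairE (eq_conv (G := fun l c => \sum_(a < (N z).+1)
    p a z * conv (fun i j => w i z (D a X Y j z) (Z c z)) l)) => [|l c].
  by rewrite conv_big; apply: eq_bigr => a _; rewrite tpairE conv_mulr.
rewrite (eq_conv (G := fun i j => \sum_(a < (N z).+1)
    p a z * w i z (D a X Y j z) (Z c z))) => [|i j].
  by rewrite conv_big; apply: eq_bigr => a _; rewrite conv_mulr.
by apply: form_sum => // a; exact: (lc_tangent (lD a)).
Qed.

Lemma tpair_antisym Y Z k z : (forall k, tangent z (Y k z)) ->
  (forall k, tangent z (Z k z)) -> tpair w Y Z k z = - tpair w Z Y k z.
Proof.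
move=> tY tZ; apply/eqP; rewrite -addr_eq0; apply/eqP; rewrite !tpairE.
have -> : conv (fun l c => conv (fun a b => w a z (Z b z) (Y c z)) l) k =
    conv (fun l c => conv (fun a b => w a z (Z c z) (Y b z)) l) k.
  by rewrite -!convA; apply: eq_conv => a l; exact: convC.
rewrite -convD; apply: conv_eq0 => l c; rewrite -convD; apply: conv_eq0 => a b.
by rewrite (form_antisym (w_2form _) (tY _) (tZ _)) addNr.
Qed.

Lemma pair_nablar X Y Z k z : (forall k, tangent z (Y k z)) ->
  tpair w Y (nabla X Z) k z = \sum_(a < (N z).+1) p a z * tpair w Y (D a X Z) k z.
Proof.
move=> tY; rewrite tpair_antisym// => [|j]; last exact: tangent_nabla.
rewrite pair_nablal// -sumrN; apply: eq_bigr => a _.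
rewrite -mulrN -tpair_antisym// => j; exact: (lc_tangent (lD a)).
Qed.

(** [D a X Y] is smooth on [U a] only; its product with [p a] extends by zero, because [p a]
    vanishes off a closed set contained in [U a]. *)
Lemma is_tfield_nabla V X Y : open V -> is_tfield V X -> is_tfield V Y ->
  is_tfield V (nabla X Y).
Proof.
move=> oV fX fY k.
have fD a : is_field V (fscale (p a) (D a X Y k)).
  apply: is_field_local => z Vz; have [Uz|nUz] := pselect (U a z).
    have oVU : open (V `&` U a) by apply: openI => //; exact: darboux_open (dU a).
    exists (V `&` U a); split=> //; apply: is_field_scale.
      by apply: smooth_sub (sp a).
    apply: (lc_field (lD a)) => //.
      by apply: is_tfield_sub fX => ? [].
    by apply: is_tfield_sub fY => ? [].
  exists (~` S a); split; [exact: closed_openC|by move=> /SU|].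
  apply: (is_field_eq (X := 0)); last exact: is_field0.
  by move=> v /p0 pv; apply/funext => h; rewrite /fscale pv mul0r.
(* The cutoff may jump from point to point; on [W (N z)] the sum is rewritten with the fixed cutoff
   [N z]. *)
apply: is_field_local => z Vz; exists (V `&` W (N z)); split=> //; first exact: openI.
apply: (is_field_eq (X := \sum_(a < (N z).+1) fscale (p a) (D a X Y k))).
  move=> v [Vv Wv]; apply/funext => h.
  by rewrite nablaE (sum_partition (fun a => D a X Y k v h) Wv) !fct_sumE.
by apply: is_field_sum => a _; apply: is_field_sub (fD a) => ? [].
Qed.

Lemma nabla_tconnection : @connection M (formal_calculus M) nabla.
Proof.
split=> /=.
- by move=> V X Y oV fX fY; exact: is_tfield_nabla.
- move=> V X X' Y Y' oV fX fX' fY fY' XX' YY' k z Vz.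
  apply/funext => h; rewrite !nablaE; apply: eq_bigr => a _.
  by rewrite (lc_local w_nondeg (dU a) (lD a) oV Vz _ fX fX' fY fY').
- move=> V X X' Y oV fX fX' fY k z Vz; apply/funext => h.
  change (nabla (X + X') Y k z h = nabla X Y k z h + nabla X' Y k z h).
  rewrite !nablaE -big_split; apply: eq_bigr => a _ /=; rewrite -mulrDr.
  by rewrite (lc_addl w_nondeg (dU a) (lD a)).
- move=> V X Y Y' oV fX fY fY' k z Vz; apply/funext => h.
  change (nabla X (Y + Y') k z h = nabla X Y k z h + nabla X Y' k z h).
  rewrite !nablaE -big_split; apply: eq_bigr => a _ /=; rewrite -mulrDr.
  by rewrite (lc_addr w_nondeg (dU a) (lD a) oV Vz).
- move=> V f X Y oV sf fX fY k z Vz; apply/funext => h.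
  rewrite nablaE tscaleE (eq_conv (G := fun i j => \sum_(a < (N z).+1)
      p a z * (f i z * D a X Y j z h))) => [|i j]; last first.
    by rewrite nablaE mulr_sumr; apply: eq_bigr => a _; rewrite mulrCA.
  rewrite conv_big; apply: eq_bigr => a _; rewrite -conv_mulr -tscaleE.
  by rewrite (lc_scalel w_nondeg (dU a) (lD a)).
- move=> V f X Y oV sf fX fY k z Vz; apply/funext => h.
  change (nabla X (tscale f Y) k z h =
    tscale (tapp X f) Y k z h + tscale f (nabla X Y) k z h).
  rewrite nablaE [in RHS]tscaleE [X in _ = _ + X]tscaleE.
  rewrite [X in _ = _ + X](eq_conv (G := fun i j => \sum_(a < (N z).+1)
      p a z * (f i z * D a X Y j z h))) => [|i j]; last first.
    by rewrite nablaE mulr_sumr; apply: eq_bigr => a _; rewrite mulrCA.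
  rewrite conv_big -tscaleE.
  (* The term with [X f] is spread over the charts as its own average, so that the Leibniz rule can
     be compared chart by chart. *)
  rewrite -[X in _ = X + _](affine (F := fun=> tscale (tapp X f) Y k z h) (z := z))//.
  rewrite -big_split; apply: eq_bigr => a _ /=; rewrite -conv_mulr -tscaleE -mulrDr.
  have [Uz|/p_neq0 ->] := pselect (U a z); last by rewrite !mul0r.
  by rewrite (lc_leibniz w_nondeg (dU a) (lD a) oV Vz).
Qed.

(** In a fixed chart around the point, membership in [P] means killing the [x' i]. This condition is
    linear, and each [D a X Y] satisfies it on the overlap. *)
Lemma nabla_P V X Y : open V -> is_tfield V X -> P V Y -> P V (nabla X Y).
Proof.
move=> oV fX PY; have fY := P_field oV PY; apply: P_glue => // z Vz.
have [U' [x' [y' [dU' U'z]]]] := P_local z.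
have oV' : open (V `&` U') by apply: openI => //; exact: darboux_open dU'.
exists (V `&` U'); split=> //.
apply/(darboux_P dU' _ oV') => [? []//|]; split.
  by apply: (is_tfield_sub (U := V)); [move=> ? []|exact: is_tfield_nabla].
move=> i k v [Vv U'v]; rewrite tapp_nabla.
apply: (affine (F := fun a => tapp (D a X Y) (x' i) k v)) => a Uv.
have oV2 : open (V `&` U' `&` U a) by apply: openI => //; exact: darboux_open (dU a).
have V2V : V `&` U' `&` U a `<=` V by move=> ? [[]].
have V2U' : V `&` U' `&` U a `<=` U' by move=> ? [[]].
have V2U : V `&` U' `&` U a `<=` U a by move=> ? [].
have PD : P (V `&` U' `&` U a) (D a X Y).
  apply: (lc_P (dU a) (lD a) oV2 V2U); first exact: is_tfield_sub fX.
  exact: P_restrict PY.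
by have [_ ->] := (darboux_P dU' _ oV2 V2U').1 PD.
Qed.

Lemma nabla_bott U' x' y' D' V X Y k z : darboux w P U' x' y' ->
  local_connection U' x' y' D' -> open V -> V `<=` U' -> P V X -> P V Y -> V z ->
  nabla X Y k z = D' X Y k z.
Proof.
move=> dU' lD' oV VU' PX PY Vz; apply: nabla_affine => a Uz.
exact: (bott_unique w_nondeg w_2form k (dU a) (lD a) dU' lD' P_restrict oV).
Qed.

(** On [P] along [P] the average is the local [D'], which acts on components as plain
    differentiation. The agreement holds on all of [V], so it may be differentiated. *)
Lemma nabla_flat V X Y Z k z : open V -> P V X -> P V Y -> P V Z -> V z ->
  nabla X (nabla Y Z) k z - nabla Y (nabla X Z) k z
    = nabla (tbracket X Y) Z k z.
Proof.
move=> oV PX PY PZ Vz.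
have [U' [x' [y' [dU' U'z]]]] := P_local z.
have [D' lD'] := local_connection_exists w_nondeg dU'.
wlog VU' : V oV PX PY PZ Vz / V `<=` U'.
  have oVU : open (V `&` U') by apply: openI => //; exact: darboux_open dU'.
  have VUV : V `&` U' `<=` V by move=> ? [].
  move=> H; apply: (H (V `&` U')) => //; first exact: P_restrict PX.
    exact: P_restrict PY.
  exact: P_restrict PZ.
have [fX fY fZ] : [/\ is_tfield V X, is_tfield V Y & is_tfield V Z].
  by split; exact: P_field.
have E A B : P V A -> P V B -> forall l v, V v -> nabla A B l v = D' A B l v.
  by move=> PA PB l v Vv; exact: (nabla_bott l dU' lD' oV).
(* The inner derivative [nabla B Z] is again in [P], which allows the outer [nabla] to be replaced
   by [D'] as well. *)
have comp A B f l : P V A -> P V B -> coord x' y' f ->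
    tapp (nabla A (nabla B Z)) f l z = tapp A (tapp B (tapp Z f)) l z.
  move=> PA PB cf; have PBZ : P V (nabla B Z) by apply: nabla_P => //; exact: P_field.
  have sf : is_tfunc V f by exact: (coord_tfunc dU' _ cf).
  rewrite tappE /tap (eq_conv (G := fun i j => D' A (nabla B Z) i z (f j)));
    last by move=> i j; rewrite E.
  rewrite -/(tap (fun i => D' A (nabla B Z) i z) f l) -tappE (lc_tapp lD')//.
  apply: (tapp_eq (U := V)) => //; first exact: P_field.
    by apply: is_tfunc_tapp => //; exact: P_field.
  move=> j v Vv; rewrite -(lc_tapp lD' B Z j (VU' v Vv) cf) !tappE.
  by apply: eq_conv => a b; rewrite E.
have e : forall k, (nabla X (nabla Y Z) - nabla Y (nabla X Z)) k z =
    (D' (tbracket X Y) Z) k z.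
  apply: (tfield_eq w_nondeg dU' U'z).
  - move=> l; apply: tangentD; first exact: tangent_nabla.
    by apply: tangentN; exact: tangent_nabla.
  - by move=> l; exact: (lc_tangent lD').
  move=> f l cf; have sf : is_tfunc V f by exact: (coord_tfunc dU' _ cf).
  rewrite (lc_tapp lD')// (tapp_bracket (U := V))//; last exact: is_tfunc_tapp.
  rewrite -!comp//; apply/eqP; rewrite eq_sym subr_eq -tapp_addl; apply/eqP.
  by rewrite subrK.
have := e k; rewrite -E// ; exact: (P_bracket dU').
Qed.

Lemma nabla_symplectic : @P_symplectic_connection M (formal_calculus M) (tpair w) P nabla.
Proof.
split=> /=.
- exact: nabla_tconnection.
- move=> V X Y Z oV fX fY fZ k z Vz.
  change (tapp X (tpair w Y Z) k z =
    tpair w (nabla X Y) Z k z + tpair w Y (nabla X Z) k z).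
  have tY l : tangent z (Y l z) by have [tY _] := fY l; exact: tY.
  have tZ l : tangent z (Z l z) by have [tZ _] := fZ l; exact: tZ.
  rewrite pair_nablal// pair_nablar// -big_split /=; apply/esym.
  under eq_bigr do rewrite -mulrDr.
  apply: (affine (F := fun a => tpair w (D a X Y) Z k z + tpair w Y (D a X Z) k z)).
  by move=> a Uz; rewrite (lc_form (dU a) (lD a) oV Vz).
- move=> V X Y oV fX fY k z Vz; apply/funext => h.
  change (nabla X Y k z h - nabla Y X k z h = tbracket X Y k z h).
  rewrite !nablaE -sumrB; under eq_bigr do rewrite -mulrBr.
  apply: (affine (F := fun a => D a X Y k z h - D a Y X k z h)) => a Uz.
  by rewrite -(lc_torsion w_nondeg (dU a) (lD a) oV Vz).
- by move=> V X Y oV fX PY; exact: nabla_P.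
- move=> V X Y Z oV PX PY PZ k z Vz.
  change (nabla X (nabla Y Z) k z - nabla Y (nabla X Z) k z
    - nabla (tbracket X Y) Z k z = 0).
  by rewrite (nabla_flat k oV PX PY PZ Vz) subrr.
Qed.

End Nabla.

Lemma symplectic_connection_exists :
  exists nabla, @P_symplectic_connection M (formal_calculus M) (tpair w) P nabla.
Proof.
pose G (U : set M) := exists x y, darboux w P U x y.
have G0 : G set0.
  exists (fun=> 0), (fun=> 0); split=> //.
  - exact: open0.
  - by move=> i k; exact: smooth_cst.
  - by move=> i k; exact: smooth_cst.
  - by move=> k v [].
  - move=> V X oV V0; split=> [PX|_].
      by split=> [|i k z /V0//]; exact: P_field.
    by apply: P_glue => // z /V0.
have Gcov (z : M) : exists U, [/\ G U, open U & U z].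
  have [U [x [y [dU Uz]]]] := P_local z.
  by exists U; split=> //; [exists x, y|exact: darboux_open dU].
have [U [S [W [p [H1 H2 [oW Wc] H3 H4]]]]] := partition_of_unity G0 Gcov.
have /choice[q dq] : forall a, exists q : ('I_m -> tfunc M) * ('I_m -> tfunc M),
    darboux w P (U a) q.1 q.2.
  by move=> a; have [[x [y dU]] _ _] := H1 a; exists (x, y).
have /choice[D lD] : forall a, exists D,
    local_connection (U a) (q a).1 (q a).2 D.
  by move=> a; exact: local_connection_exists (dq a).
have /choice[N WN] := Wc.
exists (nabla p D N); apply: (nabla_symplectic dq lD (S := S) (W := W)) => //.
- by move=> a; have [] := H1 a.
- by move=> a; have [] := H1 a.
- by move=> a; have [] := H2 a.
- by move=> a; have [] := H2 a.
Qed.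

End Gluing.

(** * From formal to ordinary connections *)

Section ConstantSeries.
Variables (R : realType) (n : nat) (M : smoothManifold R n).
Implicit Types (U V : set M) (f : cfunc M) (X Y Z : vfield M).

Definition cst_series (V : nmodType) (a : V) : nat -> V :=
  fun k => if k is 0%N then a else 0.

Lemma cst_seriesD (V : nmodType) (a b : V) :
  cst_series (a + b) = (fun k => cst_series a k + cst_series b k).
Proof. by apply/funext => -[|k] //=; rewrite addr0. Qed.

Lemma cst_series_tfield U X : is_field U X -> is_tfield U (cst_series X : tfield M).
Proof. by move=> fX [|k] //=; exact: is_field0. Qed.

Lemma cst_series_tfunc U f : smooth U f -> is_tfunc U (cst_series f : tfunc M).
Proof. by move=> sf [|k] //=; exact: smooth_cst. Qed.

Lemma conv_cst (V : nmodType) (F : nat -> nat -> V) :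
  (forall i j, (i + j != 0)%N -> F i j = 0) -> conv F = cst_series (F 0%N 0%N).
Proof.
move=> F0; apply/funext => -[|k]; first exact: conv0.
by rewrite /conv big1// => i _; apply: F0; rewrite subnKC// -ltnS.
Qed.

Lemma tscale_cst f X :
  tscale (cst_series f) (cst_series X) = (cst_series (fscale f X) : tfield M).
Proof.
apply/funext => k; apply/funext => z; apply/funext => h; rewrite tscaleE conv_cst.
  by case: k.
by move=> [|i] [|j] //= _; rewrite ?mul0r ?mulr0.
Qed.

Lemma tapp_cst U (X : tfield M) f k z : U z -> is_tfield U X ->
  tapp X (cst_series f) k z = X k z f.
Proof.
move=> Uz fX; rewrite tappE tapE big1 ?add0r// => i _.
have [tX _] := fX i.
rewrite -[RHS](tangent_vec0 (tX z Uz)).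
by case: (k - i)%N (subn_gt0 i k) => [|j _ //]; rewrite ltn_ord.
Qed.

End ConstantSeries.

(* Writing a series as [X_0 + t * X'], the Leibniz rule for [f = t] shows that
   modulo [t] a connection only depends on its arguments modulo [t]. *)
Section OrderZero.
Variables (R : realType) (n : nat) (M : smoothManifold R n).
Variables (D : tfield M -> tfield M -> tfield M).
Hypothesis cD : @connection M (formal_calculus M) D.

Lemma tfield_decomp (X : tfield M) :
  X = cst_series (X 0%N : vfield M)
      + tscale (fun k _ => (k == 1%N)%:R) (fun k => X k.+1) :> tfield M.
Proof.
apply/funext => k; apply/funext => z; apply/funext => h.
change (X k z h = (cst_series (X 0%N : vfield M) k : vfield M) z h
  + tscale (fun k _ => (k == 1%N)%:R) (fun k => X k.+1) k z h).
rewrite tscaleE; case: k => [|k] /=.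
  by rewrite conv0 mul0r addr0.
rewrite /conv big_ord_recl mul0r add0r big_ord_recl/= mul1r !subSS subn0 big1 ?addr0//.
  by rewrite add0r.
by move=> i _; rewrite mul0r.
Qed.

Lemma connection0r U (X Y : tfield M) z : open U -> U z -> is_tfield U X ->
  is_tfield U Y -> D X (cst_series (Y 0%N : vfield M)) 0%N z = D X Y 0%N z.
Proof.
move=> oU Uz fX fY; pose t : tfunc M := fun k _ => (k == 1%N)%:R.
pose Y' : tfield M := fun k => Y k.+1.
have fY0 : is_tfield U (cst_series (Y 0%N : vfield M)).
  by apply: cst_series_tfield; exact: fY.
have fY' : is_tfield U Y' by move=> k; exact: fY.
have st : is_tfunc U t by move=> k; exact: smooth_cst.
have ftY : is_tfield U (tscale t Y') by exact: is_tfield_scale.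
rewrite [in RHS](tfield_decomp Y) -/t -/Y'.
have /= -> := conn_addr cD oU fX fY0 ftY 0%N z Uz.
apply/esym; apply/funext => h.
change (D X (cst_series (Y 0%N : vfield M)) 0%N z h + D X (tscale t Y') 0%N z h =
  D X (cst_series (Y 0%N : vfield M)) 0%N z h).
have /= -> := conn_leibniz cD oU st fX fY' 0%N z Uz.
change (D X (cst_series (Y 0%N : vfield M)) 0%N z h + (tscale (tapp X t) Y' 0%N z h +
  tscale t (D X Y') 0%N z h) = D X (cst_series (Y 0%N : vfield M)) 0%N z h).
rewrite !tscaleE !conv0 tappE /tap conv0 /t /= mul0r.
have [tX _] := fX 0%N.
(* The formal function [t] has order-zero coefficient 0, which every tangent vector kills. *)
by rewrite (tangent_vec0 (tX z Uz)) mul0r !addr0.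
Qed.

Lemma connection0l U (X Y : tfield M) z : open U -> U z -> is_tfield U X ->
  is_tfield U Y -> D (cst_series (X 0%N : vfield M)) Y 0%N z = D X Y 0%N z.
Proof.
move=> oU Uz fX fY; pose t : tfunc M := fun k _ => (k == 1%N)%:R.
pose X' : tfield M := fun k => X k.+1.
have fX0 : is_tfield U (cst_series (X 0%N : vfield M)).
  by apply: cst_series_tfield; exact: fX.
have fX' : is_tfield U X' by move=> k; exact: fX.
have st : is_tfunc U t by move=> k; exact: smooth_cst.
have ftX : is_tfield U (tscale t X') by exact: is_tfield_scale.
rewrite [in RHS](tfield_decomp X) -/t -/X'.
have /= -> := conn_addl cD oU fX0 ftX fY 0%N z Uz.
apply/esym; apply/funext => h.
change (D (cst_series (X 0%N : vfield M)) Y 0%N z h + D (tscale t X') Y 0%N z h =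
  D (cst_series (X 0%N : vfield M)) Y 0%N z h).
have /= -> := conn_scalel cD oU st fX' fY 0%N z Uz.
by rewrite tscaleE conv0 /t /= mul0r addr0.
Qed.

End OrderZero.

Section Reduction.
Variables (R : realType) (n : nat) (M : smoothManifold R n).
Variables (w : cform M) (P : M -> set (tvec M)).
Hypothesis wP : polarized_symplectic w P.
Implicit Types (U V : set M) (f : cfunc M) (X Y Z : vfield M).

Definition series_form : tform M := cst_series (w : M -> tvec M -> tvec M -> R[i]).
Definition series_sections (U : set M) : set (tfield M) :=
  fun T => forall k, bundle_sections P U (T k).

(** [series_sections] constrains every coefficient, so the zero coefficients of a constant series
    must lie in [P] too. *)
Lemma polarization0 z : P z 0.
Proof.
have [U [x [y [oU Uz _ _ PE]]]] := pol_local wP z.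
by apply/(PE z Uz); split=> //; exact: tangent0.
Qed.

Lemma series_form_2form k : is_2form (series_form k).
Proof.
case: k => [|k]; first exact: pol_2form wP.
split=> [z a u v v' _ _ _|z u v _ _|U X Y _ _ _] /=.
- by rewrite /series_form /= mulr0 addr0.
- by rewrite /series_form /= oppr0.
- exact: smooth_cst.
Qed.

Lemma series_darboux z : exists U x y, darboux series_form series_sections U x y /\ U z.
Proof.
have [U [x [y [oU Uz [sxy _] wE PE]]]] := pol_local wP z.
exists U, (fun i => cst_series (x i)), (fun i => cst_series (y i)); split=> //; split=> //.
- by move=> i; apply: cst_series_tfunc; have [] := sxy i.
- by move=> i; apply: cst_series_tfunc; have [] := sxy i.
- move=> k v Uv u u' tu tu'; rewrite !fct_sumE.
  under eq_bigr do rewrite tdwedgeE.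
  rewrite (eq_bigr (fun i => cst_series (u (y i) * u' (x i) - u' (y i) * u (x i)) k)).
    case: k => [|k] /=; last by rewrite big1.
    by rewrite /series_form /= (wE v Uv u u' tu tu') !fct_sumE.
  move=> i _; rewrite conv_cst// => a b ab.
  have u0 := tangent_vec0 tu; have u'0 := tangent_vec0 tu'.
  have z0 t : tangent v t -> t (0 : cfunc M) = 0 by exact: tangent_vec0.
  by case: a b ab => [|a] [|b] //= _; rewrite !z0// ?mul0r ?mulr0 ?mul0r subrr.
- move=> V X oV VU; split=> [PX|[fX X0] k].
    have fX : is_tfield V X by move=> k; have [] := PX k.
    split=> // i k v Vv; rewrite (tapp_cst _ _ Vv fX).
    have [_ PXv] := PX k.
    by have [_ ->] := (PE v (VU v Vv) _).1 (PXv v Vv).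
  split=> [|v Vv]; first exact: fX.
  apply/(PE v (VU v Vv)); split=> [|i]; first by have [tX _] := fX k; exact: tX.
  by rewrite -(tapp_cst _ _ Vv fX) X0.
Qed.

Lemma series_connection_exists : exists D,
  @P_symplectic_connection M (formal_calculus M) (tpair series_form) series_sections D.
Proof.
apply: symplectic_connection_exists.
- exact: pol_nondeg wP.
- exact: series_form_2form.
- by move=> U X oU PX k; have [] := PX k.
- move=> U V X oU oV VU PX k; have [fX PXk] := PX k.
  by split=> [|v /VU]; [exact: is_field_sub fX|exact: PXk].
- move=> U X oU H k; split=> [|v Uv].
    apply: is_field_local => v /H[V [oV Vv VU PX]]; exists V; split=> //.
    by have [] := PX k.
  by have [V [oV Vv VU PX]] := H v Uv; have [_] := PX k; apply.
- exact: series_darboux.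
Qed.

Lemma polarized_connection_exists : exists nabla,
  @P_symplectic_connection M (smooth_calculus M) (fpair w) (bundle_sections P) nabla.
Proof.
have [D HD] := series_connection_exists; have cD := psc_connection HD.
pose c X : tfield M := cst_series X.
have fc U X : is_field U X -> is_tfield U (c X) by exact: cst_series_tfield.
have sc U f : smooth U f -> is_tfunc U (cst_series f : tfunc M) by exact: cst_series_tfunc.
have cP U X : bundle_sections P U X -> series_sections U (c X).
  move=> PX [|k] //; split=> [|v _]; first exact: is_field0.
  exact: polarization0.
have cD_add X Y : c (X + Y) = c X + c Y by exact: cst_seriesD.
exists (fun X Y => D (c X) (c Y) 0%N); split=> /=.
- split=> /=.
  + by move=> U X Y oU fX fY; exact: (conn_on cD oU (fc _ _ fX) (fc _ _ fY) 0%N).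
  + move=> U X X' Y Y' oU fX fX' fY fY' XX' YY' z Uz.
    apply: (conn_local cD oU (fc _ _ fX) (fc _ _ fX') (fc _ _ fY) (fc _ _ fY')) => //.
      by move=> [|k] v Uv //=; exact: XX'.
    by move=> [|k] v Uv //=; exact: YY'.
  + move=> U X X' Y oU fX fX' fY z Uz; rewrite cD_add.
    exact: (conn_addl cD oU (fc _ _ fX) (fc _ _ fX') (fc _ _ fY) 0%N z Uz).
  + move=> U X Y Y' oU fX fY fY' z Uz; rewrite cD_add.
    exact: (conn_addr cD oU (fc _ _ fX) (fc _ _ fY) (fc _ _ fY') 0%N z Uz).
  + move=> U f X Y oU sf fX fY z Uz; rewrite /c -tscale_cst.
    rewrite (conn_scalel cD oU (sc _ _ sf) (fc _ _ fX) (fc _ _ fY) 0%N z Uz).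
    apply/funext => h.
    change (tscale (cst_series f) (D (c X) (c Y)) 0%N z h = f z * D (c X) (c Y) 0%N z h).
    by rewrite tscaleE conv0.
  + move=> U f X Y oU sf fX fY z Uz; rewrite /c -tscale_cst.
    rewrite (conn_leibniz cD oU (sc _ _ sf) (fc _ _ fX) (fc _ _ fY) 0%N z Uz).
    apply/funext => h.
    change (tscale (tapp (c X) (cst_series f)) (c Y) 0%N z h
      + tscale (cst_series f) (D (c X) (c Y)) 0%N z h =
      X z f * Y z h + f z * D (c X) (c Y) 0%N z h).
    by rewrite !tscaleE !conv0 tappE /tap conv0.
- move=> U X Y Z oU fX fY fZ z Uz.
  have H : tapp (c X) (tpair series_form (c Y) (c Z)) 0%N z =
      tpair series_form (D (c X) (c Y)) (c Z) 0%N z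
      + tpair series_form (c Y) (D (c X) (c Z)) 0%N z.
    exact: (psc_form HD oU (fc _ _ fX) (fc _ _ fY) (fc _ _ fZ) 0%N z Uz).
  have e A B : tpair series_form A B 0%N = fpair w (A 0%N) (B 0%N).
    by apply/funext => v; rewrite tpairE !conv0.
  by move: H; rewrite tappE /tap conv0 !e.
- move=> U X Y oU fX fY z Uz.
  have := psc_torsion HD oU (fc _ _ fX) (fc _ _ fY) 0%N z Uz.
  change (D (c X) (c Y) 0%N z - D (c Y) (c X) 0%N z = tbracket (c X) (c Y) 0%N z -> 
    D (c X) (c Y) 0%N z - D (c Y) (c X) 0%N z = bracket X Y z).
  by move=> ->; apply/funext => h; rewrite tbracketE conv0.
- by move=> U X Y oU fX PY; exact: (psc_preserves HD oU (fc _ _ fX) (cP _ _ PY) 0%N).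
- move=> U X Y Z oU PX PY PZ z Uz.
  have [fX fY fZ] : [/\ is_field U X, is_field U Y & is_field U Z].
    by split; [case: PX|case: PY|case: PZ].
  have fD A B : is_field U A -> is_field U B -> is_tfield U (D (c A) (c B)).
    by move=> fA fB; exact: (conn_on cD oU (fc _ _ fA) (fc _ _ fB)).
  have := psc_flat HD oU (cP _ _ PX) (cP _ _ PY) (cP _ _ PZ) 0%N z Uz.
  change (D (c X) (D (c Y) (c Z)) 0%N z - D (c Y) (D (c X) (c Z)) 0%N z
      - D (tbracket (c X) (c Y)) (c Z) 0%N z = 0 ->
    D (c X) (c (D (c Y) (c Z) 0%N)) 0%N z - D (c Y) (c (D (c X) (c Z) 0%N)) 0%N z
      - D (c (bracket X Y)) (c Z) 0%N z = 0).
  (* Iterating the order-zero part truncates the inner derivative, or the bracket, to a constant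
     series; order zero of the outer derivative does not see the truncation, so the formal flatness
     applies. *)
  rewrite /c (connection0r cD oU Uz (fc _ _ fX) (fD _ _ fY fZ)).
  rewrite (connection0r cD oU Uz (fc _ _ fY) (fD _ _ fX fZ)).
  have -> : bracket X Y = tbracket (c X) (c Y) 0%N.
    by apply/funext => v; apply/funext => h; rewrite tbracketE conv0.
  rewrite (connection0l cD oU Uz _ (fc _ _ fZ))//.
  by apply: is_tfield_bracket => //; exact: fc.
Qed.

End Reduction.

Theorem proposition5p2 (R : realType) (n : nat) (M : smoothManifold R n) :
  (forall (w : cform M) (P : M -> set (tvec M)),
     polarized_symplectic w P ->
     exists nabla : vfield M -> vfield M -> vfield M,
       @P_symplectic_connection M (smooth_calculus M)
         (fpair w) (bundle_sections P) nabla)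
  /\
  (forall (w : tform M) (P : set M -> set (tfield M)),
     formal_polarized_symplectic w P ->
     exists nabla : tfield M -> tfield M -> tfield M,
       @P_symplectic_connection M (formal_calculus M)
         (tpair w) P nabla).
Proof.
split=> [w P wP|w P wP]; first exact: polarized_connection_exists wP.
have sP := fpol_subbundle wP.
apply: symplectic_connection_exists.
- exact: fpol_nondeg wP.
- exact: fpol_2form wP.
- exact: fsub_field sP.
- exact: fsub_restrict sP.
- exact: fsub_glue sP.
move=> z; have [U [x [y [oU Uz [sxy _] wE PE]]]] := fpol_local wP z.
exists U, x, y; split=> //; split=> // i; first by have [] := sxy i.
by have [] := sxy i.
Qed.
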